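(* Let $\delta$ be a $J\times L$ matrix whose entries are free polynomials in $d$ variables, and let $B_\delta=\{x\in\mathbb{M}^d:\|\delta(x)\|<1\}$. Then the model cone $\mathcal{C}$, consisting of all functions on $B_\delta\boxtimes B_\delta$ of the form \[ (\lambda,\mu)\mapsto \bigl(\mathrm{id}_{\mathbb{C}^L}\otimes u(\mu)^*\bigr)\Bigl(\mathrm{id}-\bigl(\delta(\mu)^*\delta(\lambda)\bigr)\otimes\mathrm{id}_{\mathcal{H}}\Bigr)\bigl(\mathrm{id}_{\mathbb{C}^L}\otimes u(\lambda)\bigr), \] where $\mathcal{H}$ is some Hilbert space and $u\in\mathrm{Hol}_{\mathcal{H}}(B_\delta)$ is an nc-function, is closed in the space of ($L\times L$ matrix-valued) hereditary holomorphic functions $\mathrm{Her}(B_\delta)$.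
   Context: Hilbert spaces are complex. $\mathbb{M}_n^d$ is the set of $d$-tuples of $n\times n$ complex matrices, $\mathbb{M}^d=\bigcup_{n\ge1}\mathbb{M}^d_n$, and $E_n=E\cap\mathbb{M}^d_n$. A set $\Omega\subseteq\mathbb{M}^d$ is finitely open iff each $\Omega_n$ is open in $\mathbb{M}^d_n$; $B_\delta$ is finitely open and closed under direct sums. A free polynomial is a polynomial in $d$ non-commuting variables with complex coefficients; for $x\in\mathbb{M}^d_n$, $\delta(x)$ is the operator $\mathbb{C}^L\otimes\mathbb{C}^n\to\mathbb{C}^J\otimes\mathbb{C}^n$ obtained by evaluating the entries of $\delta$ at $x$, and $\|\delta(x)\|$ is its operator norm. For a Hilbert space $\mathcal{H}$ and finitely open $\Omega$, $\mathrm{Hol}_{\mathcal{H}}(\Omega)$ is the set of functions $f$ on $\Omega$ such that for every $n$, $f(\lambda)\in\mathcal{B}(\mathbb{C}^n,\mathbb{C}^n\otimes\mathcal{H})$ for $\lambda\in\Omega_n$ and $f|\Omega_n$ is holomorphic. Such an $f$ is an nc-function if $f(\lambda\oplus\mu)=f(\lambda)\oplus f(\mu)$ whenever $\lambda,\mu,\lambda\oplus\mu\in\Omega$ (identifying $(\mathbb{C}^m\otimes\mathcal{H})\oplus(\mathbb{C}^n\otimes\mathcal{H})$ with $\mathbb{C}^{m+n}\otimes\mathcal{H}$), and $f(S\lambda S^{-1})=(S\otimes\mathrm{id}_{\mathcal{H}})f(\lambda)S^{-1}$ whenever $S$ is an invertible $n\times n$ matrix and $\lambda,S\lambda S^{-1}\in\Omega_n$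 (operations on $d$-tuples are componentwise). For $\lambda\in(B_\delta)_n$, $\mathrm{id}_{\mathbb{C}^L}\otimes u(\lambda)$ maps $\mathbb{C}^L\otimes\mathbb{C}^n$ to $\mathbb{C}^L\otimes\mathbb{C}^n\otimes\mathcal{H}$, and $\delta(\mu)^*\delta(\lambda)$ acts on $\mathbb{C}^L\otimes\mathbb{C}^n$, so elements of $\mathcal{C}$ take values in $\mathcal{B}(\mathbb{C}^L\otimes\mathbb{C}^n)$ at $(\lambda,\mu)\in(B_\delta)_n\times(B_\delta)_n$. Let $\Omega\boxtimes\Omega=\bigcup_{n\ge1}\Omega_n\times\Omega_n$. A subset $K$ of $\Omega\boxtimes\Omega$ is finitely compact if $K\cap(\Omega_n\times\Omega_n)$ is compact for every $n$ and empty for all large $n$. The scalar space of hereditary holomorphic functions on $\Omega$ is the completion, in the topology of uniform convergence on finitely compact subsets of $\Omega\boxtimes\Omega$, of the space of functions $A(\lambda,\mu)=v(\mu)^*u(\lambda)$ with $u,v\in\mathrm{Hol}_{\mathcal{K}}(\Omega)$ for some finite dimensional Hilbert space $\mathcal{K}$, realized as a space of functions on $\Omega\boxtimes\Omega$. The $L\times L$ matrix-valued version, meant in the claim, consists of the $L\times L$ matrices of such functions, i.e. functions taking values in $\mathcal{B}(\mathbb{C}^L\otimes\mathbb{C}^n)$ on $\Omega_n\times\Omega_n$, with the topology of uniform convergence on finitely compact subsets of $\Omega\boxtimes\Omega$. *)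

(* Defs.v *)
From HB Require Import structures.
From mathcomp Require Import all_boot all_order all_algebra.
From mathcomp Require Import sesquilinear spectral complex monalg.
From mathcomp Require Import all_classical all_reals all_analysis.

Set Implicit Arguments.
Unset Strict Implicit.
Unset Printing Implicit Defensive.

Import Order.TTheory GRing.Theory Num.Theory.
Import numFieldNormedType.Exports.

Local Open Scope classical_set_scope.
Local Open Scope ring_scope.
Local Open Scope sesquilinear_scope.

(* The complex numbers, packaged as a numClosedFieldType so that the topology
   and norm instances of abstract numeric fields apply. *)
Definition cplx (R : realType) : numClosedFieldType := R[i].

(* The inner product is linear in its first argument, conjugate-linear in its
   second one. *)
Record hilbert (R : realType) := Hilbert {
  hsort :> completeNormedModType (cplx R);
  hdot : {dot hsort for Num.conj};
  hdotE : forall x : hsort, `|x| ^+ 2 = hdot x x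
}.

Definition finite_dimensional (R : realType) (H : hilbert R) : Prop :=
  exists (k : nat) (e : 'I_k -> H), forall x : H,
    exists c : 'I_k -> cplx R, x = \sum_i c i *: e i.

Section HilbertMatrices.
Context (R : realType) (H : hilbert R).
Local Notation C := (cplx R).

(* X : 'M[H]_(p, q) stands for the operator C^q -> C^p (x) H that maps the
   basis vector e_j to \sum_i e_i (x) X i j. *)

(* (A (x) id_H) X *)
Definition hmul p q r (A : 'M[C]_(p, q)) (X : 'M[H]_(q, r)) : 'M[H]_(p, r) :=
  \matrix_(i, j) \sum_k A i k *: X k j.

(* X B *)
Definition hmulr p q r (X : 'M[H]_(p, q)) (B : 'M[C]_(q, r)) : 'M[H]_(p, r) :=
  \matrix_(i, j) \sum_k B k j *: X i k.

(* Y^* X *)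
Definition hadjmul p q r (Y : 'M[H]_(p, q)) (X : 'M[H]_(p, r)) : 'M[C]_(q, r) :=
  \matrix_(i, j) \sum_k hdot H (X k j) (Y k i).

End HilbertMatrices.

(* A d-tuple of n x n matrices, flattened to a d x (n * n) matrix. *)
Notation mtuple R d n := 'M[cplx R]_(d, n * n).

Section MatrixTuples.
Context (R : realType) (d : nat).
Local Notation C := (cplx R).

Definition coord n (x : mtuple R d n) (r : 'I_d) : 'M[C]_n :=
  vec_mx (row r x).

Definition of_coord n (f : 'I_d -> 'M[C]_n) : mtuple R d n :=
  \matrix_(r < d) mxvec (f r).

Definition tuple_dsum m n (x : mtuple R d m) (y : mtuple R d n) :
    mtuple R d (m + n) :=
  of_coord (fun r => block_mx (coord x r) 0 0 (coord y r)).

Definition tuple_conj n (S : 'M[C]_n) (x : mtuple R d n) : mtuple R d n :=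
  of_coord (fun r => S *m coord x r *m invmx S).

End MatrixTuples.

(* Free polynomials in d variables: the algebra over C of the free monoid on
   'I_d. *)
Definition freepoly (R : realType) (d : nat) := {malg (cplx R)[{fmonom 'I_d}]}.

Definition freeval (R : realType) d n (x : mtuple R d n.+1)
    (p : freepoly R d) : 'M[cplx R]_n.+1 :=
  mmap (@scalar_mx (cplx R) n.+1)
    (fun w : {fmonom 'I_d} => \prod_(r <- fmonom_val w) coord x r) p.

(* The operator C^L (x) C^n -> C^J (x) C^n, as a block matrix. *)
Definition mxfreeval (R : realType) d J L (delta : 'M[freepoly R d]_(J, L)) n
    (x : mtuple R d n.+1) :
    'M[cplx R]_(\sum_(j < J) n.+1, \sum_(l < L) n.+1) :=
  \mxblock_(j < J, l < L) freeval x (delta j l).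

Definition l2norm (R : realType) n (v : 'cV[cplx R]_n) : R :=
  Num.sqrt (\sum_i complex.Re `|v i 0| ^+ 2).

Definition opnorm (R : realType) m n (A : 'M[cplx R]_(m, n)) : R :=
  sup [set l2norm (A *m v) | v in [set v | l2norm v <= 1]].

(* A subset of M^d is given by its levels. Matrix sizes are positive: the
   level of index n consists of d-tuples of (n + 1) x (n + 1) matrices. *)
Definition ncset (R : realType) (d : nat) := forall n : nat, set (mtuple R d n.+1).

Definition poly_ball (R : realType) d J L (delta : 'M[freepoly R d]_(J, L)) :
    ncset R d :=
  fun n => [set x | opnorm (mxfreeval delta x) < 1].
Arguments poly_ball {R d J L} delta n.

Section Hol.
Context (R : realType) (d : nat) (Omega : ncset R d) (H : hilbert R).
Arguments Omega : clear implicits.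

(* Functions are total; since Omega is (finitely) open wherever it is used,
   hol and ncfun only depend on the values on Omega. *)
Definition graded := forall n : nat, mtuple R d n.+1 -> 'M[H]_n.+1.

(* B(C^n, C^n (x) H) is the finite power H^(n * n), hence holomorphy (complex
   Frechet differentiability) is entrywise. *)
Definition hol (f : graded) : Prop :=
  forall n x, Omega n x -> forall i j, differentiable (fun y => f n y i j) x.

Definition ncfun (f : graded) : Prop :=
  (forall m n (x : mtuple R d m.+1) (y : mtuple R d n.+1),
     Omega m x -> Omega n y -> Omega (m + n.+1)%N (tuple_dsum x y) ->
     f (m + n.+1)%N (tuple_dsum x y) = block_mx (f m x) 0 0 (f n y)) /\
  (forall n (S : 'M[cplx R]_n.+1) (x : mtuple R d n.+1), S \in unitmx ->
     Omega n x -> Omega n (tuple_conj S x) ->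
     f n (tuple_conj S x) = hmulr (hmul S (f n x)) (invmx S)).

End Hol.

Section Hereditary.
Context (R : realType) (d : nat) (Omega : ncset R d).
Arguments Omega : clear implicits.
Local Notation C := (cplx R).

(* A subset of Omega [x] Omega is given by its levels. *)
Definition boxset := forall n, set (Omega n * Omega n).

Definition finitely_compact (K : boxset) : Prop :=
  (forall n, compact (K n)) /\ exists N, forall n, (N <= n)%N -> K n = set0.

(* Functions on Omega [x] Omega whose values at level n are p n x p n
   matrices, with the uniform structure of uniform convergence on finitely
   compact sets. *)
Definition hfun (p : nat -> nat) := forall n, Omega n -> Omega n -> 'M[C]_(p n).

HB.instance Definition _ p := gen_eqMixin (hfun p).
HB.instance Definition _ p := gen_choiceMixin (hfun p).

Section Uniform.
Context (p : nat -> nat).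

(* Any norm on 'M_(p n), e.g. the operator norm, yields the same uniform
   structure, as only finitely many levels meet K. *)
Definition hfun_close (K : boxset) (e : C) : set (hfun p * hfun p) :=
  [set AB | forall n x y, K n (x, y) -> `|AB.1 n x y - AB.2 n x y| < e].

Definition hfun_ent : set_system (hfun p * hfun p) :=
  [set E | exists (K : boxset) (e : C),
     [/\ finitely_compact K, 0 < e & hfun_close K e `<=` E]].

Local Lemma hfun_ent_filter : Filter hfun_ent.
Proof.
split.
- exists (fun=> set0), 1; split=> //; split=> [n|]; first exact: compact0.
  by exists 0%N.
- move=> E F [K [e [[Kc [N KN]] e0 KE]]] [K' [e' [[Kc' [N' KN']] e0' KE']]].
  have cee : (e >=< e')%R by apply: real_comparable; exact: gtr0_real.
  exists (fun n => K n `|` K' n), (Num.min e e'); split.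
  + split=> [n|]; first exact: compactU.
    exists (maxn N N') => n; rewrite geq_max => /andP[Nn Nn'].
    by rewrite KN// KN'// setU0.
  + by rewrite comparable_lt_min// e0.
  + move=> AB ABee; split; [apply: KE|apply: KE'] => n x y Kxy.
      have := ABee n x y (or_introl Kxy).
      by rewrite comparable_lt_min// => /andP[].
    have := ABee n x y (or_intror Kxy).
    by rewrite comparable_lt_min// => /andP[].
- by move=> E F EF [K [e [? ? KE]]]; exists K, e; split=> //; exact: subset_trans EF.
Qed.

Local Lemma hfun_ent_refl E : hfun_ent E -> diagonal `<=` E.
Proof.
move=> [K [e [_ e0 KE]]] [A B]/= /diagonalP/= <-; apply: KE => n x y _ /=.
by rewrite subrr normr0.
Qed.

Local Lemma hfun_ent_inv E : hfun_ent E -> hfun_ent E^-1%relation.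
Proof.
move=> [K [e [Kc e0 KE]]]; exists K, e; split=> // -[A B] AB; apply: KE.
by move=> n x y Kxy; rewrite distrC; exact: AB.
Qed.

Local Lemma hfun_ent_split E :
  hfun_ent E -> exists2 F, hfun_ent F & (F \; F `<=` E)%relation.
Proof.
move=> [K [e [Kc e0 KE]]]; exists (hfun_close K (e / 2)).
  by exists K, (e / 2); split=> //; rewrite divr_gt0.
move=> [A B] [D AD DB]; apply: KE => n x y Kxy /=.
rewrite -(subrKA (D n x y)) (le_lt_trans (ler_normD _ _))//.
by rewrite [e]splitr ltrD//; [exact: AD|exact: DB].
Qed.

HB.instance Definition _ := isUniform.Build (hfun p)
  hfun_ent_filter hfun_ent_refl hfun_ent_inv hfun_ent_split.

End Uniform.

(* (lambda, mu) |-> v(mu)^* u(lambda) *)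
Definition elementary_her : set (hfun S) :=
  [set A | exists K : hilbert R, finite_dimensional K /\
     exists u v : graded d K, [/\ hol Omega u, hol Omega v &
       A = fun n x y => hadjmul (v n (val y)) (u n (val x))]].

(* The space of all functions on Omega [x] Omega being complete and
   separated, the completion, realized as a space of functions, is the
   closure. *)
Definition scalar_her : set (hfun S) := closure elementary_her.

Definition her (L : nat) : set (hfun (fun n => \sum_(l < L) n.+1)%N) :=
  [set A | forall l l' : 'I_L,
     scalar_her (fun n x y => submxblock (A n x y) l l')].

End Hereditary.

Arguments elementary_her {R d} Omega.
Arguments scalar_her {R d} Omega.
Arguments her {R d} Omega L.

(* mxdiag is id_(C^L) (x) u, and W - hmul D W is (id - D (x) id_H) W. *)
Definition model_cone (R : realType) d J L (delta : 'M[freepoly R d]_(J, L)) :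
    set (hfun (poly_ball delta) (fun n => \sum_(l < L) n.+1)%N) :=
  [set A | exists (H : hilbert R) (u : graded d H),
     [/\ hol (poly_ball delta) u, ncfun (poly_ball delta) u &
       A = fun n x y =>
         let W z := \mxdiag_(l < L) u n z in
         let D := (mxfreeval delta (val y))^t* *m mxfreeval delta (val x) in
         hadjmul (W (val y)) (W (val x) - hmul D (W (val x)))]].
Arguments model_cone {R d J L} delta.

(* Main.v *)
Require Import Defs.
From HB Require Import structures.
From mathcomp Require Import all_boot all_order all_algebra.
From mathcomp Require Import sesquilinear complex monalg.
From mathcomp Require Import all_classical all_reals all_analysis.
From mathcomp Require Import ring.

(* Let A be a limit of elements A_i of the model cone, with models u_i with
   values in H_i, along an ultrafilter. Since ||delta(x)|| < 1, the diagonal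
   value A_i(x, x) controls ||u_i(x)||^2, so the families (u_i(x))_i are bounded
   and define a function u with values in the ultraproduct of the H_i. Both the
   model formula and the nc-function identities are relations between finite
   sums and inner products, so they pass to the limit.
   Holomorphy of u needs no complex analysis: A is locally bounded on the
   diagonal, hence u is, and a locally bounded nc-function on an open set closed
   under direct sums is differentiable, its derivative at x in the direction h
   being the upper right block of u([x, h; 0, x]).
   Conversely, a block of an element of the model cone is a finite sum of terms
   v(y)^* w(x) with v, w holomorphic and H-valued; on a compact set the values of
   w are uniformly close to their projections on a finite dimensional space. *)

Set Implicit Arguments.
Unset Strict Implicit.
Unset Printing Implicit Defensive.

Import Order.TTheory GRing.Theory Num.Theory.
Import numFieldNormedType.Exports.

Local Open Scope classical_set_scope.
Local Open Scope ring_scope.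
Local Open Scope sesquilinear_scope.

(* [coord] alone denotes the coordinates of a vector space basis. *)
Local Notation coord := Defs.coord.

(** * Inner products *)

(** The models of the approximants live in unrelated Hilbert spaces, and a kernel determines its
    model at best up to isometry, so there is no common space in which the u_i could converge. Their
    mutual inner products at any two points do converge along an ultrafilter, and the ultraproduct
    is one space that realises these limits for all points at once. The available bound on
    ||u_i(x)||^2 is a diagonal value of A_i divided by 1 - ||delta(x)||^2; it uses the strict
    inequality in the definition of the ball and depends on x. The resulting limit is therefore only
    pointwise, and holomorphy does not pass to it directly. It is recovered from A, whose hereditary
    holomorphy yields bounds near the diagonal, and from the nc-structure, which survives pointwise
    limits: differences and derivatives of u at one level are corners of values of u at a higher
    level, so local boundedness there controls both. *)

Section MakeDot.
Context (R : realType) (V : lmodType (cplx R)) (f : V -> V -> cplx R).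
Hypothesis f_linear : forall a u v w, f (a *: u + v) w = a * f u w + f v w.
Hypothesis f_conj : forall u v, f u v = (f v u)^*.
Hypothesis f_pos : forall u, u != 0 -> 0 < f u u.

Let f_bilinear :
  bilinear_for (GRing.Scale.Law.clone _ _ *%R _)
    (GRing.Scale.Law.clone _ _ (Num.conj \; *%R) _) f.
Proof.
split=> u a v w; first exact: f_linear.
by rewrite f_conj f_linear rmorphD rmorphM/= -!f_conj.
Qed.

Let f_hermitian u v : f u v = (-1) ^+ false * (f v u)^*.
Proof. by rewrite mul1r -f_conj. Qed.

HB.instance Definition _ :=
  @bilinear_isBilinear.Build (cplx R) V V (cplx R) _ _ f f_bilinear.
HB.instance Definition _ :=
  @isHermitianSesquilinear.Build (cplx R) V false Num.conj f f_hermitian.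
HB.instance Definition _ := isDotProduct.Build (cplx R) V f f_pos.

Definition make_dot : {dot V for Num.conj} := f.

End MakeDot.

Section DotNorm.
Context (R : realType) (V : lmodType (cplx R)) (f : {dot V for Num.conj}).
Local Notation C := (cplx R).

Definition dnorm (u : V) : C := sqrtC (f u u).

Lemma dnorm_nneg u : 0 <= dnorm u.
Proof. exact: sqrt_dnorm_ge0. Qed.

Lemma sqr_dnorm u : dnorm u ^+ 2 = f u u.
Proof. exact: sqrtCK. Qed.

Lemma dotC u v : f u v = (f v u)^*.
Proof. by rewrite hermC /= mul1r. Qed.

Lemma dotZl a u v : f (a *: u) v = a * f u v.
Proof. exact: linearZl_LR. Qed.

Lemma dotZr a u v : f u (a *: v) = a^* * f u v.
Proof. exact: linearZr_LR. Qed.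

Lemma dotDl u v w : f (u + v) w = f u w + f v w.
Proof. exact: linearDl. Qed.

Lemma dotDr u v w : f w (u + v) = f w u + f w v.
Proof. exact: linearDr. Qed.

Lemma dotBl u v w : f (u - v) w = f u w - f v w.
Proof. exact: linearBl. Qed.

Lemma dotNr u w : f w (- u) = - f w u.
Proof. exact: linearNr. Qed.

Lemma dot0l v : f 0 v = 0.
Proof. exact: linear0l. Qed.

Lemma dot0r v : f v 0 = 0.
Proof. exact: linear0r. Qed.

Lemma dot_suml I (s : seq I) (P : pred I) (F : I -> V) v :
  f (\sum_(i <- s | P i) F i) v = \sum_(i <- s | P i) f (F i) v.
Proof. by elim/big_rec2: _ => [|i x y _ <-]; rewrite ?dot0l ?dotDl. Qed.

Lemma dot_sumr I (s : seq I) (P : pred I) (F : I -> V) v :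
  f v (\sum_(i <- s | P i) F i) = \sum_(i <- s | P i) f v (F i).
Proof. by elim/big_rec2: _ => [|i x y _ <-]; rewrite ?dot0r ?dotDr. Qed.

Lemma dot_cauchy_schwarz u v : `|f u v| <= dnorm u * dnorm v.
Proof.
rewrite -(@ler_pXn2r _ 2)// ?nnegrE ?mulr_ge0 ?dnorm_nneg//.
rewrite exprMn !sqr_dnorm.
have [->|v0] := eqVneq v 0; first by
  rewrite linear0r normr0 expr0n/= mulr_ge0// dnorm_ge0.
have vp : 0 < f v v by rewrite dnorm_gt0.
have vr : (f v v)^* = f v v by rewrite geC0_conj// ltW.
rewrite -(ler_pM2l vp) -subr_ge0.
(* The squared norm of this vector is [f v v] times the difference of the two squared sides, so no
   division by [f v v] occurs. *)
have := dnorm_ge0 f (f v v *: u - f u v *: v).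
rewrite dnormB !dnormZ (ger0_norm (ltW vp)) !normCK.
rewrite !dotZl !dotZr !rmorphM/= !conjCK vr => h.
apply: le_trans h _; rewrite le_eqVlt; apply/orP; left; apply/eqP.
by rewrite /GRing.scale/=; ring.
Qed.

Lemma dnorm_triangle u v : dnorm (u + v) <= dnorm u + dnorm v.
Proof.
rewrite -(@ler_pXn2r _ 2)// ?nnegrE ?addr_ge0 ?dnorm_nneg//.
rewrite sqrrD !sqr_dnorm dnormD -!addrA lerD2l.
rewrite [leLHS]addrC [leRHS]addrA lerD2r.
have := dot_cauchy_schwarz u v; set d := f u v => h.
have dr : d + d^* \is Num.real by rewrite CrealE rmorphD /= conjCK addrC.
apply: le_trans (real_ler_norm dr) _; apply: le_trans (ler_normD _ _) _.
by rewrite norm_conjC lerD.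
Qed.

Lemma dnorm_scale a u : dnorm (a *: u) = `|a| * dnorm u.
Proof.
by rewrite /dnorm dnormZ sqrtCM ?nnegrE ?exprn_ge0 ?dnorm_ge0// sqrCK.
Qed.

Lemma dnorm_eq0P u : dnorm u = 0 -> u = 0.
Proof. by move/eqP; rewrite sqrtC_eq0 dnorm_eq0 => /eqP. Qed.

(** Completeness in a weak form that is easy to check: only sequences with geometric steps, and a
    limit that need only be approached at some indices. The clause [2^-1 ^+ n < e] ties such an
    index to the radii of [dot_spaceP]. *)
Definition dot_complete := forall u : nat -> V,
  (forall n, dnorm (u n.+1 - u n) <= 2^-1 ^+ n) ->
  exists l, forall e : C, 0 < e ->
    exists n, dnorm (u n - l) < e /\ 2^-1 ^+ n < e.

(** An alias of [V] that carries the completeness proof, so that the norm of [f] becomes a canonical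
    structure without competing with one that [V] already has, such as the sup norm of matrices. *)
Definition dot_space of dot_complete : Type := V.

Section Space.
Context (cf : dot_complete).
HB.instance Definition _ := GRing.Lmodule.on (dot_space cf).
HB.instance Definition _ := Lmodule_isNormed.Build C (dot_space cf)
  dnorm_triangle dnorm_scale dnorm_eq0P.

Lemma dot_spaceP (F : set_system (dot_space cf)) :
  ProperFilter F -> cauchy F -> cvg F.
Proof.
move=> FF /cauchyP Fc.
(* [F] contains a ball of each radius 2^-n / 2; consecutive ones meet, so their centres are at
   distance at most 2^-n. *)
have h2 n : 0 < (2^-1 : C) ^+ n / 2 by rewrite divr_gt0// exprn_gt0// invr_gt0.
have [u Fu] : {u : nat -> dot_space cf &
    forall n, F (ball (u n) (2^-1 ^+ n / 2))}.
  by apply: (choice (fun n => Fc _ (h2 n))).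
have uS n : dnorm (u n.+1 - u n) <= 2^-1 ^+ n.
  have [x []] := filter_ex (filterI (Fu n) (Fu n.+1)).
  rewrite -!ball_normE /ball_ /= => h1 h3.
  have -> : u n.+1 - u n = (u n.+1 - x) - (u n - x) by rewrite opprB addrA
    subrK.
  apply: le_trans (ler_normB (_ : dot_space cf) _) _.
  rewrite [leRHS]splitr lerD// ltW//; apply: lt_le_trans h3 _.
  by rewrite ler_pM2r// exprS ger_pMl ?exprn_gt0// invf_le1 ?ler1n.
have [l hl] := cf uS.
apply/cvg_ex; exists (l : dot_space cf); apply/cvgrPdist_lt => /= e e0.
have [n [nl ne]] := hl _ (divr_gt0 e0 (ltr0Sn _ 1) : 0 < e / 2).
apply: filterS (Fu n) => x; rewrite -ball_normE /ball_ /= => hx.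
rewrite -(subrKA (u n)); apply: le_lt_trans (ler_normD _ _) _.
rewrite [e]splitr ltrD//; first by rewrite distrC.
apply: lt_trans hx _; apply: le_lt_trans ne.
by rewrite ler_piMr// ?exprn_ge0// invf_le1 ?ler1n.
Qed.

HB.instance Definition _ := Uniform_isComplete.Build (dot_space cf) dot_spaceP.

Let f_linear a (u v w : dot_space cf) : f (a *: u + v) w = a * f u w + f v w.
Proof. by rewrite -dotZl -linearDl. Qed.

Definition dot_hilbert : hilbert R :=
  @Hilbert R (dot_space cf)
    (@make_dot R (dot_space cf) f f_linear dotC (neq0_dnorm_gt0 (s := f)))
    sqr_dnorm.

End Space.
End DotNorm.

Section HilbertTheory.
Context (R : realType) (H : hilbert R).
Local Notation C := (cplx R).

Lemma hilbert_dnorm (x : H) : dnorm (hdot H) x = `|x|.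
Proof. by rewrite /dnorm -hdotE sqrCK. Qed.

Lemma hdot_le (x y : H) : `|hdot H x y| <= `|x| * `|y|.
Proof. by rewrite -!hilbert_dnorm dot_cauchy_schwarz. Qed.
End HilbertTheory.

(** * Tuples of matrices *)

Section Differentiability.
Context (K : numFieldType) (V W : normedModType K).

(** The order of [K] is partial, but positive elements are real and hence comparable. *)
Lemma gt0_lower_bound (a b : K) :
  0 < a -> 0 < b -> exists c, [/\ 0 < c, c <= a & c <= b].
Proof.
move=> a0 b0; have /orP[ab|ba] := real_leVge (gtr0_real a0) (gtr0_real b0).
  by exists a; split.
by exists b; split.
Qed.

(** A quadratic remainder is o(h). The candidate [D] is a bare function because in [nc_holomorphic]
    it is built by rescaling, its linearity being proved afterwards. *)
Lemma differentiable_sqr_remainder (f D : V -> W) (x : V) (C r k : K) :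
  linear D -> 0 <= C -> (forall h, `|D h| <= C * `|h|) -> 0 < r -> 0 < k ->
  (forall h, `|h| < r -> `|f (h + x) - f x - D h| <= k * `|h| ^+ 2) ->
  differentiable f x.
Proof.
move=> Dlin C0 Dbnd r0 k0 frem.
pose Dm := GRing.isLinear.Build _ _ _ _ _ Dlin.
pose L : {linear V -> W} := HB.pack D Dm.
have Lc : continuous L.
  apply/bounded_linear_continuous/linear_boundedP.
  exists C; split => [|M CM h]; first exact: ger0_real.
  by rewrite (le_trans (Dbnd h))// ler_wpM2r// ltW.
have Lf : f \o shift x = cst (f x) + L +o_ (0 : V) id.
  apply/eqaddoP => e e0.
  have [c [c0 cr ce]] := gt0_lower_bound r0 (divr_gt0 e0 k0).
  apply/nbhs_ballP; exists c => //= h; rewrite -ball_normE/= sub0r normrN => hc.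
  rewrite /shift/= -[in leLHS]/(f (h + x) - (f x + D h)) opprD addrA.
  apply: le_trans (frem _ (lt_le_trans hc cr)) _.
  rewrite expr2 mulrA ler_wpM2r//.
  by rewrite mulrC -ler_pdivlMr// (le_trans (ltW hc)).
apply/diff_locallyP; rewrite (diff_unique Lc Lf); split => //.
Qed.
End Differentiability.

Section Tuples.
Context (R : realType) (d : nat).
Local Notation C := (cplx R).

Lemma coord_of_coord n (g : 'I_d -> 'M[C]_n) r : coord (of_coord g) r = g r.
Proof. by rewrite /coord /of_coord rowK mxvecK. Qed.

Lemma coordB n (x y : mtuple R d n) r : coord (x - y) r = coord x r - coord y r.
Proof. by rewrite /coord !linearB. Qed.

Lemma coordBE n (x y : mtuple R d n) r i j :
  coord x r i j - coord y r i j = coord (x - y) r i j.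
Proof. by rewrite coordB [RHS]mxE [X in _ = _ + X]mxE. Qed.

Lemma coordD n (x y : mtuple R d n) r : coord (x + y) r = coord x r + coord y r.
Proof. by rewrite /coord !linearD. Qed.

Lemma coordZ n a (x : mtuple R d n) r : coord (a *: x) r = a *: coord x r.
Proof. by rewrite /coord !linearZ. Qed.

Lemma coord_inj n (x y : mtuple R d n) : (forall r, coord x r =
  coord y r) -> x = y.
Proof.
move=> xy; apply/row_matrixP => r; have := xy r; rewrite /coord.
exact: (can_inj vec_mxK).
Qed.

Lemma coordE n (x : mtuple R d n) r i j : coord x r i j = x r (mxvec_index i j).
Proof. by rewrite /coord !mxE. Qed.

Lemma mx_norm_le m n (A : 'M[C]_(m, n)) (e : C) :
  0 <= e -> (`|A| <= e <-> forall i j, `|A i j| <= e).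
Proof.
move=> e0; rewrite -[`|A|]/(mx_norm A) mx_normE.
have -> : e = (NngNum e0)%:num by [].
rewrite [_ <= _%:num]num_le; split.
  by move=> /bigmax_leP[_ h] i j; have := h (i, j) isT; rewrite -num_le.
move=> h; apply/bigmax_leP; split => [|ij _]; first by rewrite -num_le.
by rewrite -num_le /= h.
Qed.

Lemma tuple_norm_le n (x : mtuple R d n) (e : C) :
  0 <= e -> (`|x| <= e <-> forall r i j, `|coord x r i j| <= e).
Proof.
move=> e0; rewrite mx_norm_le//; split=> h r.
  by move=> i j; rewrite coordE.
by move=> k; case/mxvec_indexP: k => i j; rewrite -coordE.
Qed.

Lemma coord_norm n (x : mtuple R d n) r i j : `|coord x r i j| <= `|x|.
Proof. exact: (tuple_norm_le x (normr_ge0 x)).1. Qed.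

(** The corner [b] may be rectangular, hence a family of blocks and not an [mtuple]. *)
Definition tuple_ut m n (x : mtuple R d m) (b : 'I_d -> 'M[C]_(m, n))
    (y : mtuple R d n) : mtuple R d (m + n) :=
  of_coord (fun r => block_mx (coord x r) (b r) 0 (coord y r)).

Lemma tuple_ut_dist m n (x x' : mtuple R d m) (b b' : 'I_d ->
  'M[C]_(m, n)) (y y' : mtuple R d n) (e : C) :
  `|x - x'| <= e -> `|y - y'| <= e ->
  (forall r i j, `|b r i j - b' r i j| <= e) ->
  `|tuple_ut x b y - tuple_ut x' b' y'| <= e.
Proof.
move=> xe ye be; have e0 : 0 <= e by apply: le_trans xe.
apply/tuple_norm_le => // r i j; rewrite coordB !coord_of_coord.
rewrite opp_block_mx add_block_mx.
case: (split_ordP i) => {}i ->; case: (split_ordP j) => {}j ->.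
- rewrite block_mxEul -coordB; exact: le_trans (coord_norm _ _ _ _) xe.
- by rewrite block_mxEur !mxE.
- by rewrite block_mxEdl !mxE subr0 normr0.
- rewrite block_mxEdr -coordB; exact: le_trans (coord_norm _ _ _ _) ye.
Qed.

End Tuples.

Section Pairing.
Context (R : realType) (H : hilbert R) (w : H).
Local Notation C := (cplx R).

(** Pairing each entry with a fixed [w] turns matrices over [H] into complex ones, to which the
    block calculus of [mulmx] applies; [pairing_inj] brings the identities back. *)
Definition pairing p q (X : 'M[H]_(p, q)) : 'M[C]_(p, q) :=
  map_mx (fun v => hdot H v w) X.

Lemma pairing_hmul p q r (A : 'M[C]_(p, q)) (X : 'M[H]_(q, r)) :
  pairing (hmul A X) = A *m pairing X.
Proof.
apply/matrixP => i j; rewrite !mxE dot_suml; apply: eq_bigr => k _.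
by rewrite !mxE dotZl.
Qed.

Lemma pairing_hmulr p q r (X : 'M[H]_(p, q)) (B : 'M[C]_(q, r)) :
  pairing (hmulr X B) = pairing X *m B.
Proof.
apply/matrixP => i j; rewrite !mxE dot_suml; apply: eq_bigr => k _.
by rewrite !mxE dotZl mulrC.
Qed.
End Pairing.

Lemma pairing_inj (R : realType) (H : hilbert R) p q (X Y : 'M[H]_(p, q)) :
  (forall w, pairing w X = pairing w Y) -> X = Y.
Proof.
move=> XY; apply/matrixP => i j; apply/subr0_eq/eqP.
rewrite -(dnorm_eq0 (hdot H)); set w := _ - _.
have := XY w; move/matrixP/(_ i j); rewrite !mxE => e.
by rewrite {1}/w dotBl e subrr.
Qed.

(** * Noncommutative functions *)

Section NCFunctions.
Context (R : realType) (d : nat) (Omega : ncset R d) (H : hilbert R).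
Context (f : graded d H).
Local Notation C := (cplx R).
Hypothesis Omega_dsum : forall m n (x : mtuple R d m.+1) (y : mtuple R d n.+1),
  Omega x -> Omega y -> Omega (tuple_dsum x y : mtuple R d (m + n.+1).+1).
Hypothesis f_nc : ncfun Omega f.

(** Levels are indexed by size minus one: [(m + n.+1).+1] and [m.+1 + n.+1] are convertible, and the
    latter form lets the block projections apply to the value. *)
Definition fut m n (x : mtuple R d m.+1) b (y : mtuple R d n.+1) :
    'M[H]_(m.+1 + n.+1) := f (tuple_ut x b y : mtuple R d (m + n.+1).+1).

Lemma pairing_block (w : H) m1 m2 n1 n2 (A : 'M[H]_(m1, n1)) (B : 'M[H]_(m1,
  n2))
   (A' : 'M[H]_(m2, n1)) (B' : 'M[H]_(m2, n2)) :
  pairing w (block_mx A B A' B') =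
  block_mx (pairing w A) (pairing w B) (pairing w A') (pairing w B').
Proof. by rewrite /pairing map_block_mx. Qed.

Lemma pairing0 (w : H) m n : pairing w (0 : 'M[H]_(m, n)) = 0.
Proof. by apply/matrixP => i j; rewrite !mxE dot0l. Qed.

Lemma nc_dsumE w m n (x : mtuple R d m.+1) (y : mtuple R d n.+1) :
  Omega x -> Omega y -> pairing w (f (tuple_dsum x y : mtuple R d (m +
    n.+1).+1)) =
  block_mx (pairing w (f x)) 0 0 (pairing w (f y)).
Proof.
move=> Ox Oy; rewrite f_nc.1//; last exact: Omega_dsum.
by rewrite -(pairing0 w) -(pairing0 w) -pairing_block.
Qed.

(* The similarity by [1, T; 0, 1] fixes the direct sum of x and y when
   x T = T y. *)
Lemma nc_intertwine m n (x : mtuple R d m.+1) (y : mtuple R d n.+1)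
    (T : 'M[C]_(m.+1, n.+1)) : Omega x -> Omega y ->
  (forall r, coord x r *m T = T *m coord y r) ->
  hmulr (f x) T = hmul T (f y).
Proof.
move=> Ox Oy xT; apply: pairing_inj => w.
rewrite pairing_hmulr pairing_hmul.
pose S : 'M[C]_(m.+1 + n.+1) := block_mx 1%:M T 0 1%:M.
have Su : S \in unitmx by rewrite unitmxE det_ublock !det1 mulr1 unitr1.
pose z : mtuple R d (m + n.+1).+1 := tuple_dsum x y.
have zE : tuple_conj S z = z.
  apply: coord_inj => r; rewrite coord_of_coord.
  suff -> : (S *m coord z r) = (coord z r *m S) by rewrite mulmxK.
  rewrite coord_of_coord /S.
  rewrite (mulmx_block 1%:M T 0 1%:M (coord x r) 0 0 (coord y r)).
  rewrite (mulmx_block (coord x r) 0 0 (coord y r) 1%:M T 0 1%:M).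
  by rewrite !(mulmx0, mul0mx, mul1mx, mulmx1, addr0, add0r) xT.
have Oz := Omega_dsum Ox Oy.
have := f_nc.2 _ S z Su Oz; rewrite zE => /(_ Oz)/(congr1 (fun X => pairing w
  X)); rewrite pairing_hmulr pairing_hmul.
move/(congr1 (fun X => X *m S)); rewrite /= mulmxKV// (nc_dsumE w Ox Oy) /S.
rewrite (mulmx_block (pairing w (f x)) 0 0 (pairing w (f y)) 1%:M T 0 1%:M).
rewrite (mulmx_block 1%:M T 0 1%:M (pairing w (f x)) 0 0 (pairing w (f y))).
rewrite !(mulmx0, mul0mx, mul1mx, mulmx1, addr0, add0r).
by move=> e; have [_ -> _ _] := @eq_block_mx C _.+1 _.+1 _.+1 _.+1 _ _ _ _ _ _ _
  _ e.
Qed.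

Section UpperTriangular.
Context m n (x : mtuple R d m.+1) (b : 'I_d -> 'M[C]_(m.+1, n.+1)).
Context (y : mtuple R d n.+1).
Hypotheses (Ox : Omega x) (Oy : Omega y).
Hypothesis (Ob : Omega (tuple_ut x b y : mtuple R d (m + n.+1).+1)).

(** The inclusion [E] of the first summand and the projection [E'] onto the second intertwine the
    triangular point with [x] and with [y]. By [nc_intertwine], the first block column of the value
    is [f x] above 0, and its last block row is 0 followed by [f y]. *)
Lemma nc_utE w : pairing w (fut x b y) =
  block_mx (pairing w (f x)) (pairing w (ursubmx (fut x b y)))
    0 (pairing w (f y)).
Proof.
pose E : 'M[C]_(m.+1 + n.+1, m.+1) := col_mx 1%:M 0.
pose E' : 'M[C]_(n.+1, m.+1 + n.+1) := row_mx 0 1%:M.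
have hE r : coord (tuple_ut x b y) r *m E = E *m coord x r.
  rewrite coord_of_coord (mul_block_col (coord x r)) mul_col_mx.
  by rewrite !(mulmx0, mul0mx, mul1mx, mulmx1, addr0, add0r).
have hE' r : coord y r *m E' = E' *m coord (tuple_ut x b y) r.
  rewrite coord_of_coord (mul_row_block _ _ (coord x r)) mul_mx_row.
  by rewrite !(mulmx0, mul0mx, mul1mx, mulmx1, addr0, add0r).
have := @nc_intertwine n (m + n.+1) _ _ E' Oy Ob hE'.
have := @nc_intertwine (m + n.+1) m _ _ E Ob Ox hE.
move=> /(congr1 (fun X => pairing w X)) h2 /(congr1 (fun X => pairing w X)) h1.
move: h1 h2; rewrite !pairing_hmulr !pairing_hmul -/(fut x b y).
rewrite -[fut x b y]submxK pairing_block submxK /E /E'.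
set X := pairing w (ulsubmx _); set Y := pairing w (ursubmx _).
set Z := pairing w (dlsubmx _); set W := pairing w (drsubmx _).
rewrite (@mul_mx_row _ _ _ m.+1 n.+1 _ 0 1%:M).
rewrite (@mul_row_block _ _ m.+1 n.+1 m.+1 n.+1 0 1%:M X Y Z W).
rewrite (@mul_col_mx _ m.+1 n.+1 _ _ 1%:M 0).
rewrite (@mul_block_col _ m.+1 n.+1 m.+1 n.+1 _ X Y Z W 1%:M 0).
rewrite !(mulmx0, mul0mx, mul1mx, mulmx1, addr0, add0r) => h1 h2.
have [-> ->] := @eq_col_mx C _.+1 _.+1 _.+1 _ _ _ _ h2.
by have [_ <-] := @eq_row_mx C _.+1 _.+1 _.+1 _ _ _ _ h1.
Qed.
End UpperTriangular.

(* The upper right block is thus linear in b: take for x' the direct sum of two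
   copies of x and for t the row [a, c] of scalars. *)
Lemma nc_ut_mull m n p (x : mtuple R d m.+1) (x' : mtuple R d p.+1)
    (b : 'I_d -> 'M[C]_(p.+1, n.+1)) (y : mtuple R d n.+1)
    (t : 'M[C]_(m.+1, p.+1)) : Omega x -> Omega x' -> Omega y ->
  (forall r, coord x r *m t = t *m coord x' r) ->
  Omega (tuple_ut x (fun r => t *m b r) y : mtuple R d (m + n.+1).+1) ->
  Omega (tuple_ut x' b y : mtuple R d (p + n.+1).+1) ->
  ursubmx (fut x (fun r => t *m b r) y) = hmul t (ursubmx (fut x' b y)).
Proof.
move=> Ox Ox' Oy xt O1 O2; apply: pairing_inj => w.
pose T : 'M[C]_(m.+1 + n.+1, p.+1 + n.+1) := block_mx t 0 0 1%:M.
have hT r : coord (tuple_ut x (fun r => t *m b r) y) r *m T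
            = T *m coord (tuple_ut x' b y) r.
  rewrite !coord_of_coord (mulmx_block (coord x r)) (mulmx_block t).
  by rewrite !(mulmx0, mul0mx, mul1mx, mulmx1, addr0, add0r) xt.
have := @nc_intertwine (m + n.+1) (p + n.+1) _ _ T O1 O2 hT.
move=> /(congr1 (fun X => pairing w X)); rewrite !pairing_hmulr !pairing_hmul.
rewrite -!/(fut _ _ _) !nc_utE// (@mulmx_block _ m.+1 n.+1 m.+1 n.+1 p.+1 n.+1)
  (@mulmx_block _ m.+1 n.+1 p.+1 n.+1 p.+1 n.+1).
rewrite !(mulmx0, mul0mx, mul1mx, mulmx1, addr0, add0r) => e.
by have [_ -> _ _] := @eq_block_mx C _.+1 _.+1 _.+1 _.+1 _ _ _ _ _ _ _ _ e.
Qed.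

(** The matrix [1, t; 0, 1] intertwines the triangular point with the direct sum of [x] and [y],
    since x t + t (y - x) = t y. Scaled differences of [f] are thus corners of single values of
    [f]. *)
Lemma nc_ut_diff n (x y : mtuple R d n.+1) (t : C) : Omega x -> Omega y ->
  Omega (tuple_ut x (fun r => t *: (coord y r - coord x r)) y
         : mtuple R d (n + n.+1).+1) ->
  ursubmx (fut x (fun r => t *: (coord y r - coord x r)) y) =
  \matrix_(i, j) (t *: (f y i j - f x i j)).
Proof.
move=> Ox Oy Ot; apply: pairing_inj => w.
pose T : 'M[C]_(n.+1 + n.+1, n.+1 + n.+1) := block_mx 1%:M t%:M 0 1%:M.
have hT r : coord (tuple_ut x (fun r => t *: (coord y r - coord x r)) y) r *m T
            = T *m coord (tuple_dsum x y) r.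
  rewrite !coord_of_coord.
  rewrite (mulmx_block (coord x r)) (mulmx_block 1%:M).
  rewrite !(mulmx0, mul0mx, mul1mx, mulmx1, addr0, add0r).
  by rewrite mul_mx_scalar mul_scalar_mx scalerBr addrC subrK.
have := @nc_intertwine (n + n.+1) (n + n.+1) _ _ T Ot (Omega_dsum Ox Oy) hT.
move=> /(congr1 (fun X => pairing w X)); rewrite !pairing_hmulr !pairing_hmul.
rewrite (nc_dsumE w Ox Oy) -!/(fut _ _ _) !nc_utE//.
rewrite !(@mulmx_block _ n.+1 n.+1 n.+1 n.+1 n.+1 n.+1).
rewrite !(mulmx0, mul0mx, mul1mx, mulmx1, addr0, add0r) => e.
have [_ + _ _] := @eq_block_mx C _.+1 _.+1 _.+1 _.+1 _ _ _ _ _ _ _ _ e.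
rewrite mul_mx_scalar mul_scalar_mx => h.
apply/matrixP => i j; move/matrixP/(_ i j): h; rewrite !mxE dotZl dotBl.
by rewrite mulrBr => <-; rewrite addrC addrK.
Qed.

End NCFunctions.

(** * Holomorphy of locally bounded nc-functions *)

Section Holomorphy.
Context (R : realType) (d : nat) (Omega : ncset R d) (H : hilbert R).
Context (f : graded d H).
Local Notation C := (cplx R).
Hypothesis Omega_open : forall n (x : mtuple R d n.+1),
  Omega x -> \forall y \near x, Omega y.
Hypothesis Omega_dsum : forall m n (x : mtuple R d m.+1) (y : mtuple R d n.+1),
  Omega x -> Omega y -> Omega (tuple_dsum x y : mtuple R d (m + n.+1).+1).
Hypothesis f_nc : ncfun Omega f.
Hypothesis f_bounded : forall n (x : mtuple R d n.+1), Omega x ->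
  exists M : C, \forall y \near x, forall i j, `|f y i j| <= M.

Lemma nearby_ball n (x : mtuple R d n) (P : set (mtuple R d n)) :
  (\forall y \near x, P y) -> exists2 r : C, 0 < r & forall y,
    `|y - x| < r -> P y.
Proof.
move=> /nbhs_ballP[r /= r0 rP]; exists r => // y yx; apply: rP.
by rewrite -ball_normE/= distrC.
Qed.

Lemma half_lt (r : C) : 0 < r -> r / 2 < r.
Proof. by move=> r0; rewrite ltr_pdivrMr// ltr_pMr// ltr1n. Qed.

(** A difference of values, magnified by t, is a corner of one value of [f] near the direct sum of
    two copies of [x], where [f] is bounded by [M]. Taking t |y - z| = r / 2 keeps that point within
    [r1]; the constant uses [M + 1] in order to be positive. *)
Lemma nc_lipschitz n (x : mtuple R d n.+1) : Omega x ->
  exists r k : C, [/\ 0 < r, 0 < k & forall y z,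
    `|y - x| < r -> `|z - x| < r ->
    [/\ Omega y, Omega z & forall i j, `|f y i j - f z i j| <= k * `|y - z|]].
Proof.
move=> Ox; have Oxx := Omega_dsum Ox Ox.
have [M Mb] := f_bounded Oxx.
have [r1 r10 r1P] := nearby_ball (filterI (Omega_open Oxx) Mb).
have [r2 r20 r2P] := nearby_ball (Omega_open Ox).
have [r [r0 rr1 rr2]] := gt0_lower_bound r10 r20.
have M0 : 0 <= M.
  have /r1P[_ /(_ 0 0)] : `|tuple_dsum x x - tuple_dsum x x| < r1.
    by rewrite subrr normr0.
  exact: le_trans.
exists (r / 2), ((M + 1) * (2 / r)); split.
- by rewrite divr_gt0.
- by rewrite mulr_gt0 ?divr_gt0// ltr_wpDl.
move=> y z yx zx; have Oy : Omega y.
  by apply: r2P; rewrite (lt_trans yx)// (lt_le_trans _ rr2)// half_lt.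
have Oz : Omega z.
  by apply: r2P; rewrite (lt_trans zx)// (lt_le_trans _ rr2)// half_lt.
split=> // i j; have [->|yz] := eqVneq y z.
  by rewrite !subrr !normr0 mulr0.
have n0 : 0 < `|y - z| by rewrite normr_gt0 subr_eq0.
pose t := r / 2 / `|y - z|.
have t0 : 0 < t by rewrite !divr_gt0.
have tE : `|t| * `|y - z| = r / 2 by rewrite gtr0_norm// divfK// gt_eqF.
have hX : `|tuple_ut z (fun r => t *: (coord y r - coord z r)) y - tuple_dsum x
  x| < r1.
  apply: (@le_lt_trans _ _ (r / 2)); last by rewrite (lt_le_trans (half_lt r0)).
  apply: (@tuple_ut_dist _ _ n.+1 n.+1); [exact: ltW|exact: ltW|move=> p a b].
  rewrite -coordB mxE [X in _ - X]mxE subr0 normrM -tE ler_wpM2l//.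
  exact: coord_norm.
have [OX /(_ (lshift n.+1 i) (rshift n.+1 j))] := r1P _ hX.
have /matrixP/(_ i j) := nc_ut_diff Omega_dsum f_nc Oz Oy OX.
rewrite !mxE => -> /=; rewrite normrZ gtr0_norm// => h.
rewrite -(@ler_pM2l _ t)//; apply: le_trans h _.
have -> : t * ((M + 1) * (2 / r) * `|y - z|) = M + 1.
  rewrite /t; field; rewrite gt_eqF//= gt_eqF//.
by rewrite lerDl.
Qed.

(* With t of order 1/|h|, the points [x, t h; 0, h + x] and [x, t h; 0, x] are at
   distance |h|, and the upper right blocks of their images are
   t (f (h + x) - f x) and t D h, so the Lipschitz estimate one level up gives a
   quadratic remainder. *)
Lemma nc_holomorphic : hol Omega f.
Proof.
move=> n x Ox i j; have Oxx := Omega_dsum Ox Ox.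
have Oxxx := Omega_dsum Oxx Ox.
have [r [k [r0 k0 rk]]] := nc_lipschitz Oxx.
have [r3 r30 r3P] := nearby_ball (Omega_open Oxxx).
have [r4 r40 r4P] := nearby_ball (Omega_open Ox).
pose up (h : mtuple R d n.+1) : mtuple R d (n + n.+1).+1 :=
  tuple_ut x (coord h) x.
pose Delta h : H := f (up h) (lshift n.+1 i) (rshift n.+1 j).
have up_dist h h' : `|up h - up h'| <= `|h - h'|.
  rewrite /up; apply: (@tuple_ut_dist _ _ n.+1 n.+1);
    rewrite ?subrr ?normr0// => p a b.
  by rewrite coordBE coord_norm.
have up0 : up 0 = tuple_dsum x x.
  by congr of_coord; apply/funext => p; rewrite /coord row0 linear0.
have up_lt h : `|h| < r -> `|up h - tuple_dsum x x| < r.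
  by move=> hr; rewrite -up0 (le_lt_trans (up_dist _ _))// subr0.
have Oup h : `|h| < r -> Omega (up h).
  by move=> /up_lt hr; have [] := rk _ _ hr hr.
(* Strictly below the three radii, so that the weak bounds by [e0] used from here on give strict
   ones. *)
have [e0 [e00 e0r e0r3 e0r4]] : exists e0 : C, [/\ 0 < e0, e0 < r,
  e0 < r3 & e0 < r4].
  have [c1 [c10 c1r c1r3]] := gt0_lower_bound r0 r30.
  have [c2 [c20 c2c1 c2r4]] := gt0_lower_bound c10 r40.
  have c2h := half_lt c20; exists (c2 / 2); split; first by rewrite divr_gt0.
  - by rewrite (lt_le_trans c2h)// (le_trans c2c1).
  - by rewrite (lt_le_trans c2h)// (le_trans c2c1).
  - by rewrite (lt_le_trans c2h).
have Delta_comb u v : `|u| <= e0 -> `|v| <= e0 ->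
    exists p q, forall a c, `|a *: u + c *: v| <= e0 ->
      Delta (a *: u + c *: v) = a *: p + c *: q.
  move=> ue ve.
  pose xx : mtuple R d (n + n.+1).+1 := tuple_dsum x x.
  pose b p : 'M[C]_((n + n.+1).+1, n.+1) := col_mx (coord u p) (coord v p).
  have Ob : Omega (tuple_ut xx b x : mtuple R d ((n + n.+1) + n.+1).+1).
    apply: r3P; apply: le_lt_trans e0r3.
    apply: (@tuple_ut_dist _ _ (n + n.+1).+1 n.+1);
      rewrite ?subrr ?normr0 ?ltW// => p k1 k2.
    rewrite [X in _ - X]mxE subr0 /b.
    have [l ->|l ->] := @split_ordP n.+1 n.+1 k1.
      by rewrite (@col_mxEu _ n.+1 n.+1) (le_trans (coord_norm _ _ _ _)).
    by rewrite (@col_mxEd _ n.+1 n.+1) (le_trans (coord_norm _ _ _ _)).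
  pose Y : 'M[H]_(n.+1 + n.+1, n.+1) := ursubmx (fut f xx b x).
  exists (Y (lshift n.+1 i) j), (Y (rshift n.+1 i) j) => a c ace.
  pose T : 'M[C]_(n.+1, (n + n.+1).+1) := row_mx a%:M c%:M.
  have Tb p : T *m b p = coord (a *: u + c *: v) p.
    rewrite (@mul_row_col _ _ n.+1 n.+1) !mul_scalar_mx.
    by rewrite coordD !coordZ.
  have xT p : coord x p *m T = T *m coord xx p.
    rewrite coord_of_coord (@mul_row_block _ _ n.+1 n.+1 n.+1 n.+1).
    rewrite (@mul_mx_row _ _ _ n.+1 n.+1) !mulmx0 addr0 add0r.
    by rewrite !mul_mx_scalar !mul_scalar_mx.
  have bE : (fun p => T *m b p) = coord (a *: u + c *: v) by apply/funext.
  have OT : Omega (tuple_ut x (fun p => T *m b p) x : mtuple R d (n + n.+1).+1).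
    by rewrite bE; apply: Oup; apply: le_lt_trans e0r.
  have := nc_ut_mull Omega_dsum f_nc Ox Oxx Ox xT OT Ob.
  rewrite bE => /matrixP/(_ i j); rewrite 2!mxE => DE.
  rewrite -[LHS]/(fut f x (coord (a *: u + c *: v)) x (lshift n.+1 i) (rshift
    n.+1 j)).
  rewrite {}DE mxE (@big_split_ord _ _ _ n.+1 n.+1) /=; congr (_ + _).
    rewrite (bigD1 i)//= big1 ?addr0 => [|l li].
      by rewrite (@row_mxEl _ n.+1 n.+1 n.+1) mxE eqxx mulr1n.
    by rewrite (@row_mxEl _ n.+1 n.+1 n.+1) mxE eq_sym (negPf li) scale0r.
  rewrite (bigD1 i)//= big1 ?addr0 => [|l li].
    by rewrite (@row_mxEr _ n.+1 n.+1 n.+1) mxE eqxx mulr1n.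
  by rewrite (@row_mxEr _ n.+1 n.+1 n.+1) mxE eq_sym (negPf li) scale0r.
have Delta_lin a u v : `|u| <= e0 -> `|v| <= e0 -> `|a *: u + v| <= e0 ->
    Delta (a *: u + v) = a *: Delta u + Delta v.
  move=> ue ve uve; have [p [q pq]] := Delta_comb _ _ ue ve.
  (* [p] and [q] do not depend on the coefficients; the pairs (1, 0) and (0, 1) identify them as
     [Delta u] and [Delta v]. *)
  have := pq a 1; have := pq 1 0; have := pq 0 1.
  rewrite !scale1r !scale0r !add0r !addr0.
  by move=> /(_ ve) -> /(_ ue) -> /(_ uve) ->.
have Delta0 : Delta 0 = 0.
  have := Delta_lin 0 0 0; rewrite !scaler0 scale0r addr0 normr0 add0r.
  have := Delta_lin 1 0 0; rewrite !scaler0 scale1r addr0 normr0.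
  move=> /(_ (ltW e00) (ltW e00) (ltW e00)) h _.
  by apply: (@addIr _ (Delta 0)); rewrite -h add0r.
have DeltaZ a u : `|u| <= e0 -> `|a *: u| <= e0 ->
  Delta (a *: u) = a *: Delta u.
  move=> ue ae; have := Delta_lin a u 0; rewrite addr0 normr0 Delta0 addr0.
  by apply=> //; exact: ltW.
(* [Delta] is known to be linear only on the ball of radius [e0]; [D] extends it by homogeneity. The
   1 in the denominator keeps [s h] positive at h = 0. *)
pose s (h : mtuple R d n.+1) := e0 / (`|h| + 1).
have s0 h : 0 < s h by rewrite divr_gt0// ltr_wpDl.
have sh h : `|s h *: h| <= e0.
  rewrite normrZ gtr0_norm// /s -mulrA ler_piMr ?(ltW e00)//.
  by rewrite mulrC ler_pdivrMr ?ltr_wpDl// mul1r lerDl.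
pose D h := (s h)^-1 *: Delta (s h *: h).
have DE c h : `|c *: h| <= e0 -> Delta (c *: h) = c *: D h.
  move=> ch; have e : c *: h = (c / s h) *: (s h *: h).
    by rewrite scalerA divfK// gt_eqF.
  by rewrite /D {1}e DeltaZ -?e// scalerA.
have Dlin : linear D.
  (* A common factor that brings [h], [h'] and their combination into the ball where [Delta] is
     linear. *)
  move=> a h h'; pose c := e0 / (`|h| + `|h'| + `|a *: h + h'| + 1).
  have cd : 0 < `|h| + `|h'| + `|a *: h + h'| + 1 by rewrite ltr_wpDl//
    !addr_ge0.
  have c0 : 0 < c by rewrite divr_gt0.
  have cle (g : mtuple R d n.+1) : `|g| <=
    `|h| + `|h'| + `|a *: h + h'| + 1 -> `|c *: g| <= e0.
    move=> ge; rewrite normrZ gtr0_norm// /c -mulrA ler_piMr ?(ltW e00)//.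
    by rewrite mulrC ler_pdivrMr// mul1r.
  have ch : `|c *: h| <= e0 by apply: cle; rewrite -!addrA lerDl !addr_ge0.
  have ch' : `|c *: h'| <= e0.
    by apply: cle; rewrite [`|h| + _]addrC -!addrA lerDl !addr_ge0.
  have ch'' : `|c *: (a *: h + h')| <= e0.
    by apply: cle; rewrite -addrA ler_wpDl ?addr_ge0// lerDl.
  apply: (@scalerI _ _ c); first by rewrite gt_eqF.
  rewrite -DE// scalerDr scalerA mulrC -scalerA Delta_lin//.
    by rewrite !DE// scalerDr scalerA mulrC -scalerA.
  by rewrite scalerA mulrC -scalerA -scalerDr.
have Dbnd h : `|D h| <= k * `|h|.
  have uh : `|up (s h *: h) - tuple_dsum x x| < r.
    by apply: up_lt; exact: le_lt_trans e0r.
  have uh0 : `|up 0 - tuple_dsum x x| < r by rewrite up0 subrr normr0.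
  have [_ _ /(_ (lshift n.+1 i) (rshift n.+1 j))] := rk _ _ uh uh0.
  rewrite -/(Delta _) -/(Delta 0) Delta0 subr0 => hk.
  rewrite normrZ gtr0_norm ?invr_gt0// mulrC ler_pdivrMr//.
  apply: le_trans hk _; rewrite -mulrA ler_pM2l//.
  by apply: le_trans (up_dist _ _) _; rewrite subr0 normrZ gtr0_norm// mulrC.
(* The constant [k / e0] comes from dividing a bound k |h| by t = e0 / |h|. *)
apply: (@differentiable_sqr_remainder _ _ _ _ D x k e0 (k / e0)) => //.
- exact: ltW.
- by rewrite divr_gt0.
move=> h hlt; have [->|h0] := eqVneq h 0.
  rewrite add0r subrr sub0r normrN expr2 normr0 !mulr0.
  by rewrite (le_trans (Dbnd 0))// normr0 mulr0.
have hp : 0 < `|h| by rewrite normr_gt0.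
pose t := e0 / `|h|.
have t0 : 0 < t by rewrite divr_gt0.
have th : `|t *: h| <= e0 by rewrite normrZ gtr0_norm// divfK// gt_eqF.
have Ohx : Omega (h + x) by apply: r4P; rewrite addrK (lt_trans hlt).
pose b p : 'M[C]_n.+1 := t *: (coord (h + x) p - coord x p).
have bE : b = coord (t *: h).
  by apply/funext => p; rewrite /b -coordB addrK coordZ.
pose X : mtuple R d (n + n.+1).+1 := tuple_ut x b (h + x).
have Xx : `|X - tuple_dsum x x| < r.
  apply: le_lt_trans e0r; rewrite -up0 /X bE.
  apply: (@tuple_ut_dist _ _ n.+1 n.+1);
    rewrite ?subrr ?normr0 ?addrK ?ltW// => p k1 k2.
  rewrite coordBE subr0.
  exact: le_trans (coord_norm _ _ _ _) th.
have uh : `|up (t *: h) - tuple_dsum x x| < r.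
  by apply: up_lt; exact: le_lt_trans e0r.
have [OX _ /(_ (lshift n.+1 i) (rshift n.+1 j))] := rk _ _ Xx uh.
rewrite -/(Delta _) DE//.
have /matrixP/(_ i j) := nc_ut_diff Omega_dsum f_nc Ox Ohx OX.
rewrite !mxE => -> /=; rewrite -scalerBr normrZ gtr0_norm// => hk.
rewrite -(@ler_pM2l _ t)//; apply: le_trans hk _.
have -> : t * (k / e0 * `|h| ^+ 2) = k * `|h|.
  by rewrite /t; field; rewrite gt_eqF//= gt_eqF.
rewrite ler_pM2l// /X bE.
apply: (@tuple_ut_dist _ _ n.+1 n.+1);
  rewrite ?subrr ?normr0 ?addrK// => p k1 k2.
by rewrite subrr normr0.
Qed.
End Holomorphy.

(** * Ultraproducts of Hilbert spaces *)

Section ComplexLimits.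
Context (R : realType) (I : Type) (F : set_system I).
Local Notation C := (cplx R).

Local Notation "x %:C" := (real_complex _ x) : ring_scope.

Lemma normc_le_ReIm (z : C) : `|z| <= (`|complex.Re z| + `|complex.Im z|)%:C.
Proof.
rewrite normc_def lecR -[leRHS]ger0_norm ?addr_ge0// -[leRHS]sqrtr_sqr
  ler_wsqrtr//.
rewrite sqrrD !real_normK ?num_real// lerD2r lerDl mulrn_wge0// mulr_ge0//.
Qed.

Lemma normc_ge_Im (z : C) : `|complex.Im z|%:C <= `|z|.
Proof. by rewrite normc_def lecR -[leLHS]sqrtr_sqr ler_wsqrtr// lerDr sqr_ge0.
  Qed.

Context {FU : UltraFilter F}.

(** Compactness of a segment gives a cluster point, and a cluster point of an ultrafilter is a
    limit. *)
Lemma ultra_cvg_real (g : I -> R) (M : R) :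
  (\forall i \near F, `|g i| <= M) -> exists l : R, g @ F --> l.
Proof.
move=> gM.
have PF : ProperFilter (g @ F) by exact: fmap_proper_filter.
have gI : (g @ F) `[- M, M]%classic.
  by apply: filterS gM => i; rewrite /= in_itv/= ler_norml.
have [l [_ lF]] := segment_compact PF gI.
exists l => U Ul; rewrite /nbhs/=.
have [//|FC] := in_ultra_setVsetC (g @^-1` U) FU.
by have [y [Cy Uy]] := lF (~` U) U FC Ul.
Qed.

Lemma ultra_cvg (g : I -> C) (M : C) :
  (\forall i \near F, `|g i| <= M) -> exists l : C, g @ F --> l.
Proof.
move=> gM.
have [a ga] : exists a : R, (fun i => complex.Re (g i)) @ F --> a.
  apply: (@ultra_cvg_real _ (complex.Re M)).
  apply: filterS gM => i /(le_trans (normc_ge_Re _)).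
  by rewrite lecE => /andP[_].
have [b gb] : exists b : R, (fun i => complex.Im (g i)) @ F --> b.
  apply: (@ultra_cvg_real _ (complex.Re M)).
  apply: filterS gM => i /(le_trans (normc_ge_Im _)).
  by rewrite lecE => /andP[_].
exists (a +i* b)%C; apply/cvgrPdist_lt => e e0.
have eE : e = (complex.Re e)%:C by rewrite RRe_real// gtr0_real.
have e0' : 0 < complex.Re e / 2 by rewrite divr_gt0// -ltcR -eE.
move/cvgrPdist_lt : ga => /(_ _ e0').
move/cvgrPdist_lt : gb => /(_ _ e0') gb ga.
apply: filterS (filterI ga gb) => i [/= ai bi].
apply: le_lt_trans (normc_le_ReIm _) _.
by rewrite eE ltcR [ltRHS]splitr; case: (g i) ai bi => x y /= ai bi;
  rewrite ltrD.
Qed.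

Lemma ultra_norm_le (g : I -> C) (l M : C) : g @ F --> l ->
  (\forall i \near F, `|g i| <= M) -> `|l| <= M.
Proof.
move=> gl gM; apply/ler_addgt0Pr => e e0.
move/cvgrPdist_lt : gl => /(_ _ e0) gl.
have [i [h1 h2]] := filter_ex (filterI gM gl).
rewrite -[l](subrK (g i)) (le_trans (ler_normD _ _))// addrC lerD// ltW//.
Qed.

(** Where [g] is nonnegative it equals its absolute value, so l = |l|. *)
Lemma ultra_ge0 (g : I -> C) (l : C) : g @ F --> l ->
  (\forall i \near F, 0 <= g i) -> 0 <= l.
Proof.
move=> gl g0; have gl' : (fun i => `|g i|) @ F --> l.
  apply: cvg_trans gl; apply: near_eq_cvg.
  by apply: filterS g0 => i /ger0_norm ->.
have gl'' : (fun i => `|g i|) @ F --> (`|l| : C) by exact: cvg_norm.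
by rewrite (cvg_unique (@norm_hausdorff _ _) gl' gl'').
Qed.

Lemma ultra_conj (g : I -> C) (l : C) :
  g @ F --> l -> (fun i => (g i)^*) @ F --> l^*.
Proof.
move=> /cvgrPdist_lt gl; apply/cvgrPdist_lt => e /gl; apply: filterS => i.
by rewrite -rmorphB norm_conjC.
Qed.

End ComplexLimits.

Lemma geometric_lt (R : realType) (e : cplx R) :
  0 < e -> exists n, (2^-1 : cplx R) ^+ n < e.
Proof.
move=> e0; have eE : e = real_complex R (complex.Re e) by rewrite RRe_real//
  gtr0_real.
have e0' : 0 < complex.Re e by rewrite -ltcR -eE.
have [n _ /(_ n (leqnn n))] := near_infty_natSinv_expn_lt (PosNum e0').
rewrite /= div1r -ltcR -eE => h; exists n; apply: le_lt_trans h.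
by rewrite fmorphV rmorphXn rmorph_nat exprVn.
Qed.

Lemma geometric_dist (R : realType) (V : normedModType (cplx R)) (S : nat ->
  V) :
  (forall n, `|S n.+1 - S n| <= 2 * 2^-1 ^+ n) ->
  forall n k, `|S (n + k)%N - S n| <= 4 * 2^-1 ^+ n.
Proof.
set h : cplx R := 2^-1 => SS n k.
have h0 m : 0 < h ^+ m by rewrite exprn_gt0// invr_gt0.
(* Telescoping: 2 h^n = 4 h^n - 4 h^(n+1), so the right-hand side absorbs each step exactly. *)
have : `|S (n + k)%N - S n| <= 4 * h ^+ n - 4 * h ^+ (n + k).
  elim: k => [|k IH]; first by rewrite addn0 !subrr normr0.
  rewrite addnS -(subrKA (S (n + k)%N)) addrC.
  apply: le_trans (ler_normD _ _) _; apply: le_trans (lerD IH (SS _)) _.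
  by rewrite exprS le_eqVlt; apply/orP; left; apply/eqP; rewrite /h; field.
by move=> /le_trans; apply; rewrite gerBl mulr_ge0// ltW.
Qed.

Lemma complete_geometric (R : realType) (V : completeNormedModType (cplx R))
    (S : nat -> V) :
  (forall n, `|S n.+1 - S n| <= 2 * 2^-1 ^+ n) ->
  exists l, forall n, `|S n - l| <= 4 * 2^-1 ^+ n.
Proof.
move=> /geometric_dist Sd.
have Sc : cauchy (S @ \oo).
  apply: cauchy_exP => e e0.
  have [n hn] := geometric_lt (divr_gt0 e0 (ltr0Sn (cplx R) 3)).
  exists (S n); exists n => // k /= /subnKC <-.
  rewrite -ball_normE/= distrC; apply: le_lt_trans (Sd _ _) _.
  by rewrite mulrC -ltr_pdivlMr.
have /cvg_ex[l Sl] : cvg (S @ \oo) by exact: cauchy_cvg.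
exists l => n; apply/ler_addgt0Pr => e e0.
move/cvgrPdist_lt : Sl => /(_ _ e0) [N _ NP].
rewrite -(subrKA (S (n + N)%N)) addrC (le_trans (ler_normD _ _))// addrC lerD//.
  by rewrite distrC Sd.
by rewrite distrC ltW// NP//= leq_addl.
Qed.

(** The sequence is bounded, hence converges along an ultrafilter finer than [\oo], and the tail
    estimate of [geometric_dist] passes to that limit. *)
Lemma cplx_geometric (R : realType) (S : nat -> cplx R) :
  (forall n, `|S n.+1 - S n| <= 2 * 2^-1 ^+ n) ->
  exists l, forall n, `|S n - l| <= 4 * 2^-1 ^+ n.
Proof.
move=> /(@geometric_dist _ (cplx R)^o) Sd.
have [U [UU ooU]] := ultraFilterLemma eventually_filter.
have [|l Sl] := @ultra_cvg _ _ _ UU S (4 + `|S 0%N|).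
  apply: nearW => n; rewrite -[S n](subrK (S 0%N)) (le_trans (ler_normD _ _))//.
  by rewrite lerD2r; have := Sd 0%N n; rewrite expr0 mulr1.
exists l => n; rewrite distrC.
apply: (@ultra_norm_le _ _ _ UU (fun k => S k - S n)).
  by apply: cvgB; [exact: Sl|exact: cvg_cst].
by apply: ooU; exists n => // k /= /subnKC <-; exact: Sd.
Qed.

Section Ultraproduct.
Context (R : realType) (I : Type) (F : set_system I) (FU : UltraFilter F).
Context (E : I -> hilbert R).
Local Notation C := (cplx R).
Local Notation family := (forall i, E i).

Definition ultra_bounded (v : family) :=
  exists M : C, \forall i \near F, `|v i| <= M.

Definition ultra_gram (v w : family) : C :=
  lim ((fun i => hdot (E i) (v i) (w i)) @ F).

(** At an unbounded [w] the limit need not exist; the value 0 there keeps [ultra_fun] linear on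
    bounded families. *)
Definition ultra_fun (v : family) : family -> C :=
  fun w => if `[< ultra_bounded w >] then ultra_gram v w else 0.

Lemma ultra_gram_cvg v w : ultra_bounded v -> ultra_bounded w ->
  (fun i => hdot (E i) (v i) (w i)) @ F --> ultra_gram v w.
Proof.
move=> [M vM] [N wN].
have [|l hl] := @ultra_cvg _ _ _ FU (fun i => hdot (E i) (v i) (w i)) (M * N).
  apply: filterS (filterI vM wN) => i [vi wi].
  by apply: le_trans (hdot_le _ _) _; rewrite ler_pM.
by apply/cvg_ex; exists l.
Qed.

Lemma ultra_gramE v w (l : C) :
  (fun i => hdot (E i) (v i) (w i)) @ F --> l -> ultra_gram v w = l.
Proof. exact: (cvg_lim (@norm_hausdorff _ _)). Qed.

Lemma ultra_bounded_lin a v w : ultra_bounded v -> ultra_bounded w ->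
  ultra_bounded (fun i => a *: v i + w i).
Proof.
move=> [M vM] [N wN]; exists (`|a| * M + N).
apply: filterS (filterI vM wN) => i [vi wi].
by rewrite (le_trans (ler_normD _ _))// lerD// normrZ ler_wpM2l.
Qed.

Lemma ultra_bounded0 : ultra_bounded (fun=> 0).
Proof. by exists 0; apply: nearW => i; rewrite normr0. Qed.

Lemma ultra_gram_lin a v w z :
  ultra_bounded v -> ultra_bounded w -> ultra_bounded z ->
  ultra_gram (fun i => a *: v i + w i) z = a * ultra_gram v z + ultra_gram w z.
Proof.
move=> vb wb zb; apply: ultra_gramE.
under eq_fun do rewrite dotDl dotZl.
apply: cvgD; last exact: ultra_gram_cvg.
by apply: cvgM; [exact: cvg_cst|exact: ultra_gram_cvg].
Qed.

Lemma ultra_gram_conj v w : ultra_bounded v -> ultra_bounded w ->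
  ultra_gram v w = (ultra_gram w v)^*.
Proof.
move=> vb wb; apply: ultra_gramE; under eq_fun do rewrite dotC.
by apply: ultra_conj; exact: ultra_gram_cvg.
Qed.

Lemma ultra_fun_lin a v w : ultra_bounded v -> ultra_bounded w ->
  ultra_fun (fun i => a *: v i + w i) = a *: ultra_fun v + ultra_fun w.
Proof.
move=> vb wb; apply/funext => z; rewrite /ultra_fun !fctE.
case: asboolP => zb; last by rewrite scaler0 addr0.
exact: ultra_gram_lin.
Qed.

(* Passing through functions on families avoids a quotient: a bounded family is
   represented by the functional it induces. *)
Definition ultra_pred of UltraFilter F : {pred family -> C} :=
  fun g => `[< exists2 v, ultra_bounded v & g = ultra_fun v >].

Lemma ultra_subproof : subsemimod_closed (ultra_pred FU).
Proof.
have z : ultra_fun (fun=> 0) = 0.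
  apply/funext => w; rewrite /ultra_fun; case: asboolP => // _.
  by apply: ultra_gramE; under eq_fun do rewrite dot0l; exact: cvg_cst.
have lin a g h : g \in ultra_pred FU -> h \in ultra_pred FU ->
    a *: g + h \in ultra_pred FU.
  move=> /asboolP[v vb ->] /asboolP[w wb ->].
  apply/asboolP; exists (fun i => a *: v i + w i).
    exact: ultra_bounded_lin.
  by rewrite ultra_fun_lin.
have z' : 0 \in ultra_pred FU.
  by apply/asboolP; exists (fun=> 0); [exact: ultra_bounded0|].
split; first split=> // g h gP hP.
  by rewrite -(scale1r g); exact: lin.
by move=> a g gP; rewrite -(addr0 (a *: g)); exact: lin.
Qed.

Record ultraproduct := Ultraproduct {
  ultra_val : family -> C;
  _ : ultra_val \in ultra_pred FU }.

HB.instance Definition _ := [isSub for ultra_val].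
HB.instance Definition _ := [Choice of ultraproduct by <:].
HB.instance Definition _ :=
  GRing.SubChoice_isSubLmodule.Build _ _ (ultra_pred FU) ultraproduct
    ultra_subproof.

Lemma ultra_val_lin a (u v : ultraproduct) : val (a *: u + v) =
  a *: val u + val v.
Proof. exact: linearP. Qed.

Definition ultra_rep (q : ultraproduct) : family :=
  s2val (cid2 (asboolW (valP q))).

Lemma ultra_rep_bounded q : ultra_bounded (ultra_rep q).
Proof. exact: (s2valP (cid2 (asboolW (valP q)))). Qed.

Lemma ultra_repE q : val q = ultra_fun (ultra_rep q).
Proof. exact: (s2valP' (cid2 (asboolW (valP q)))). Qed.

(** The functional of [q] is evaluated at a representative of [q']: linearity in [q] is immediate,
    and independence of the representative follows from conjugate symmetry in [ultra_dot_class]. *)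
Definition ultra_dot_fun (q q' : ultraproduct) : C := val q (ultra_rep q').

Lemma ultra_dot_gram q q' :
  ultra_dot_fun q q' = ultra_gram (ultra_rep q) (ultra_rep q').
Proof.
by rewrite /ultra_dot_fun ultra_repE /ultra_fun asboolT//;
  exact: ultra_rep_bounded.
Qed.

(** Cauchy-Schwarz in each factor. This yields definiteness: a bounded family of limit norm 0
    induces the zero functional, which is the zero of [ultraproduct]. *)
Lemma ultra_gram_null v w : ultra_bounded v -> ultra_bounded w ->
  ultra_gram v v = 0 -> ultra_gram v w = 0.
Proof.
move=> vb [M wM] v0; apply: ultra_gramE; apply/cvgrPdist_lt => e e0.
have := ultra_gram_cvg vb vb; rewrite v0 => /cvgrPdist_lt vlim.
have M0 : 0 <= M by have [j] := filter_ex wM; exact: le_trans.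
pose c := e / (M + 1); have c0 : 0 < c by rewrite divr_gt0// ltr_wpDl.
apply: filterS (filterI wM (vlim _ (exprn_gt0 2 c0))) => i [wi].
rewrite !sub0r !normrN -hdotE normrX normr_id => vi.
have {}vi : `|v i| < c by rewrite -(@ltr_pXn2r _ 2)// nnegrE// ltW.
apply: le_lt_trans (hdot_le _ _) _; apply: (@le_lt_trans _ _ (`|v i| * M)).
  by rewrite ler_wpM2l.
have -> : e = c * (M + 1) by rewrite divfK// gt_eqF// ltr_wpDl.
apply: (@le_lt_trans _ _ (c * M)); first by rewrite ler_wpM2r// ltW.
by rewrite ltr_pM2l// ltrDl.
Qed.

Lemma ultra_dot_linear a u v w :
  ultra_dot_fun (a *: u + v) w = a * ultra_dot_fun u w + ultra_dot_fun v w.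
Proof. by rewrite /ultra_dot_fun ultra_val_lin. Qed.

Lemma ultra_dot_conj u v : ultra_dot_fun u v = (ultra_dot_fun v u)^*.
Proof. by rewrite !ultra_dot_gram; apply: ultra_gram_conj;
  exact: ultra_rep_bounded. Qed.

Lemma ultra_dot_pos u : u != 0 -> 0 < ultra_dot_fun u u.
Proof.
move=> u0; have ub := ultra_rep_bounded u.
rewrite lt_def; apply/andP; split; last first.
  rewrite ultra_dot_gram; apply: ultra_ge0 (ultra_gram_cvg ub ub) _.
  by apply: nearW => i; exact: dnorm_ge0.
apply: contra u0; rewrite ultra_dot_gram => /eqP u0; apply/eqP/val_inj.
rewrite ultra_repE; apply/funext => w; rewrite /ultra_fun.
by case: asboolP => // wb; rewrite ultra_gram_null.
Qed.

Definition ultra_dot := make_dot ultra_dot_linear ultra_dot_conj ultra_dot_pos.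

Definition ultra_class (v : family) : ultraproduct := insubd 0 (ultra_fun v).

Lemma ultra_classE v : ultra_bounded v -> val (ultra_class v) = ultra_fun v.
Proof. by move=> vb; rewrite insubdK//; apply/asboolP; exists v. Qed.

Lemma ultra_dot_class v w : ultra_bounded v -> ultra_bounded w ->
  ultra_dot (ultra_class v) (ultra_class w) = ultra_gram v w.
Proof.
move=> vb wb; have cb := ultra_rep_bounded (ultra_class w).
rewrite /ultra_dot/= /ultra_dot_fun ultra_classE// /ultra_fun asboolT//.
have e : ultra_fun (ultra_rep (ultra_class w)) = ultra_fun w.
  by rewrite -ultra_repE ultra_classE.
rewrite ultra_gram_conj// [RHS]ultra_gram_conj//; congr (_^*).
by move/(congr1 (fun g => g v)): e; rewrite /ultra_fun !asboolT.
Qed.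

Lemma ultra_class_lin a v w : ultra_bounded v -> ultra_bounded w ->
  ultra_class (fun i => a *: v i + w i) = a *: ultra_class v + ultra_class w.
Proof.
move=> vb wb; apply: val_inj; rewrite ultra_val_lin !ultra_classE//.
  exact: ultra_fun_lin.
exact: ultra_bounded_lin.
Qed.

Lemma ultra_class_eq v w : (\forall i \near F, v i = w i) ->
  ultra_class v = ultra_class w.
Proof.
move=> vw; congr insubd; apply/funext => z; rewrite /ultra_fun;
  case: asboolP => // _.
rewrite /ultra_gram; congr lim; rewrite eqEsubset; split; apply: near_eq_cvg;
  by apply: filterS vw => i ->.
Qed.

Lemma ultra_class_rep q : ultra_class (ultra_rep q) = q.
Proof.
by apply: val_inj; rewrite ultra_classE ?ultra_repE//; exact: ultra_rep_bounded.
Qed.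

Lemma ultra_dnorm_le v (e : C) : (\forall i \near F, `|v i| <= e) ->
  dnorm ultra_dot (ultra_class v) <= e.
Proof.
move=> ve; have vb : ultra_bounded v by exists e.
have e0 : 0 <= e by have [j] := filter_ex ve; exact: le_trans.
rewrite -(@ler_pXn2r _ 2)// ?nnegrE ?dnorm_nneg// sqr_dnorm.
rewrite -[leLHS]ger0_norm ?dnorm_ge0// ultra_dot_class//.
apply: ultra_norm_le (ultra_gram_cvg vb vb) _; apply: filterS ve => i vi.
by rewrite -hdotE normrX normr_id ler_pXn2r// nnegrE.
Qed.

(** The squared norms of a representative converge to that of [q]; this is how norm estimates in the
    ultraproduct descend to the factors. *)
Lemma ultra_rep_lt q (e : C) : dnorm ultra_dot q < e ->
  \forall i \near F, `|ultra_rep q i| < e.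
Proof.
move=> qe; have e0 : 0 < e by apply: le_lt_trans qe; exact: dnorm_nneg.
have qb := ultra_rep_bounded q.
have := ultra_gram_cvg qb qb; rewrite -ultra_dot_gram.
have -> : ultra_dot_fun q q = dnorm ultra_dot q ^+ 2 by rewrite sqr_dnorm.
move: qe; set m := dnorm _ _ => qe.
have m2 : m ^+ 2 < e ^+ 2 by rewrite ltr_pXn2r// nnegrE ?dnorm_nneg// ltW.
move=> /cvgrPdist_lt/(_ (e ^+ 2 - m ^+ 2)); rewrite subr_gt0 => /(_ m2).
apply: filterS => i; rewrite -hdotE distrC => h.
rewrite -(@ltr_pXn2r _ 2)// ?nnegrE ?(ltW e0)//.
rewrite -(ltrD2r (- m ^+ 2)); apply: le_lt_trans h; apply: real_ler_norm.
by rewrite realB// realX// ger0_real// dnorm_nneg.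
Qed.

(** The increments of [u] are small only on sets of [F] that depend on [n], and the intersection of
    these sets may fail to be in [F]. Replaced by 0 elsewhere, the increments keep their classes and
    are summable at every index, so that a limit can be formed in each factor. *)
Lemma ultra_complete : dot_complete ultra_dot.
Proof.
move=> u uS; set h : C := 2^-1 in uS *.
have h0 n : 0 < h ^+ n by rewrite exprn_gt0// invr_gt0.
pose w n := ultra_rep (u n.+1 - u n).
(* The factor 2 supplies the strict inequality required by [ultra_rep_lt]. *)
pose w' n : family := fun i => if `|w n i| <= 2 * h ^+ n then w n i else 0.
have ww n : \forall i \near F, w' n i = w n i.
  have : dnorm ultra_dot (u n.+1 - u n) < 2 * h ^+ n.
    by apply: le_lt_trans (uS n) _; rewrite ltr_pMl// ltr1n.
  by move=> /ultra_rep_lt; apply: filterS => i hi; rewrite /w' ltW.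
have w'le n i : `|w' n i| <= 2 * h ^+ n.
  by rewrite /w'; case: ifP => //; rewrite normr0 mulr_ge0// ltW.
pose S n : family := fun i => ultra_rep (u 0%N) i + \sum_(k < n) w' k i.
have SS n : S n.+1 = fun i => 1 *: w' n i + S n i.
  by apply: functional_extensionality_dep => i;
    rewrite /S big_ord_recr/= scale1r addrA addrC.
have w'b n : ultra_bounded (w' n) by exists (2 * h ^+ n); exact: nearW.
have Sb n : ultra_bounded (S n) /\ ultra_class (S n) = u n.
  elim: n => [|n [IHb IHe]].
    have -> : S 0%N = ultra_rep (u 0%N).
      by apply: functional_extensionality_dep => i; rewrite /S big_ord0 addr0.
    by rewrite ultra_class_rep; split=> //; exact: ultra_rep_bounded.
  rewrite SS; split; first exact: ultra_bounded_lin.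
  by rewrite ultra_class_lin// IHe (ultra_class_eq (ww n)) ultra_class_rep
    scale1r subrK.
have [L LS] : {L : family & forall i n, `|S n i - L i| <= 4 * h ^+ n}.
  have ex i : exists l : E i, forall n, `|S n i - l| <= 4 * h ^+ n.
    apply: complete_geometric => n.
    have := w'le n i; rewrite SS scale1r addrK; exact.
  exists (fun i => sval (cid (ex i))) => i n.
  exact: svalP (cid (ex i)) n.
have Lb : ultra_bounded L.
  have [[M S0M] _] := Sb 0%N; exists (4 + M); apply: filterS S0M => i hi.
  have := LS i 0%N; rewrite expr0 mulr1 distrC => h4.
  by rewrite -[L i](subrK (S 0%N i)) (le_trans (ler_normD _ _))// lerD.
exists (ultra_class L) => e e0.
have [n hn] := geometric_lt (divr_gt0 e0 (ltr0Sn C 3)).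
have hne : 4 * h ^+ n < e by rewrite mulrC -ltr_pdivlMr.
exists n; split; last first.
  by apply: le_lt_trans hne; rewrite ler_peMl ?ltW// ltr1n.
have [Snb <-] := Sb n; apply: le_lt_trans hne.
have -> : ultra_class (S n) - ultra_class L =
  ultra_class (fun i => - 1 *: L i + S n i).
  by rewrite ultra_class_lin// scaleN1r addrC.
apply: ultra_dnorm_le; apply: nearW => i.
by rewrite scaleN1r addrC.
Qed.

Definition ultra_hilbert : hilbert R := dot_hilbert ultra_complete.

Definition ultra_vec (v : family) : ultra_hilbert := ultra_class v.

Lemma ultra_vec_dot v w : ultra_bounded v -> ultra_bounded w ->
  (fun i => hdot (E i) (v i) (w i)) @ F
    --> hdot ultra_hilbert (ultra_vec v) (ultra_vec w).
Proof.
move=> vb wb; rewrite -[hdot _ _ _]/(ultra_dot (ultra_class v) (ultra_class w)).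
by rewrite ultra_dot_class//; exact: ultra_gram_cvg.
Qed.

Lemma ultra_vec_lin a v w : ultra_bounded v -> ultra_bounded w ->
  ultra_vec (fun i => a *: v i + w i) = a *: ultra_vec v + ultra_vec w.
Proof. exact: ultra_class_lin. Qed.

Lemma ultra_vec0 : ultra_vec (fun=> 0) = 0.
Proof.
have := ultra_vec_lin 1 ultra_bounded0 ultra_bounded0.
rewrite scale1r => h; apply: (@addIr _ (ultra_vec (fun=> 0))).
rewrite -h add0r; congr ultra_vec; apply: functional_extensionality_dep => i.
by rewrite scaler0 addr0.
Qed.

Lemma ultra_vec_sum n (c : 'I_n -> C) (v : 'I_n -> family) :
  (forall k, ultra_bounded (v k)) ->
  ultra_bounded (fun i => \sum_k c k *: v k i) /\
  ultra_vec (fun i => \sum_k c k *: v k i) = \sum_k c k *: ultra_vec (v k).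
Proof.
move=> vb; elim: n c v vb => [|n IH] c v vb.
  have -> : (fun i => \sum_(k < 0) c k *: v k i) = (fun=> 0).
    by apply: functional_extensionality_dep => i; rewrite big_ord0.
  by rewrite big_ord0; split; [exact: ultra_bounded0|exact: ultra_vec0].
have [b e] := IH (c \o lift ord0) (v \o lift ord0) (fun k => vb _).
have -> : (fun i => \sum_(k < n.+1) c k *: v k i) =
   (fun i => c ord0 *: v ord0 i + \sum_(k < n) c (lift ord0 k) *: v (lift ord0
     k) i).
  by apply: functional_extensionality_dep => i; rewrite big_ord_recl.
split; first exact: ultra_bounded_lin.
by rewrite ultra_vec_lin// big_ord_recl e.
Qed.

End Ultraproduct.

(** * Finite-dimensional Hilbert spaces and orthonormalization *)

Section MatrixHilbert.
Context (R : realType) (p q : nat).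
Local Notation C := (cplx R).
Local Notation M := 'M[C]_(p, q).

(** The Hilbert-Schmidt inner product. For [q] = 1 its norm is [l2norm]; in general it provides the
    finite-dimensional spaces needed for [elementary_her]. *)
Definition mx_dot_fun (A B : M) : C := \sum_i \sum_j A i j * (B i j)^*.

Lemma mx_dot_linear a u v w :
  mx_dot_fun (a *: u + v) w = a * mx_dot_fun u w + mx_dot_fun v w.
Proof.
rewrite /mx_dot_fun mulr_sumr -big_split; apply: eq_bigr => i _ /=.
rewrite mulr_sumr -big_split; apply: eq_bigr => j _ /=.
by rewrite !mxE mulrDl mulrA.
Qed.

Lemma mx_dot_conj u v : mx_dot_fun u v = (mx_dot_fun v u)^*.
Proof.
rewrite /mx_dot_fun rmorph_sum; apply: eq_bigr => i _ /=.
rewrite rmorph_sum; apply: eq_bigr => j _ /=.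
by rewrite rmorphM/= conjCK mulrC.
Qed.

Lemma mx_dotE u : mx_dot_fun u u = \sum_i \sum_j `|u i j| ^+ 2.
Proof. by apply: eq_bigr => i _; apply: eq_bigr => j _; rewrite normCK. Qed.

Lemma mx_dot_pos u : u != 0 -> 0 < mx_dot_fun u u.
Proof.
move=> u0; rewrite mx_dotE lt_def; apply/andP; split; last first.
  by rewrite sumr_ge0// => i _; rewrite sumr_ge0// => j _; rewrite exprn_ge0.
apply: contra u0; rewrite psumr_eq0 => [/allP h|i _]; last first.
  by rewrite sumr_ge0// => j _; rewrite exprn_ge0.
apply/eqP/matrixP => i j; rewrite mxE; have := h i (mem_index_enum _).
rewrite psumr_eq0 => [/allP/(_ j (mem_index_enum _))|k _];
  last by rewrite exprn_ge0.
by rewrite expf_eq0/= normr_eq0 => /eqP.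
Qed.

Definition mx_dot := make_dot mx_dot_linear mx_dot_conj mx_dot_pos.

Lemma mx_entry_le (A : M) i j : `|A i j| <= dnorm mx_dot A.
Proof.
rewrite -(@ler_pXn2r _ 2)// ?nnegrE ?dnorm_nneg// sqr_dnorm.
rewrite /mx_dot/= mx_dotE (bigD1 i)//= (bigD1 j)//= -addrA lerDl addr_ge0//.
  by rewrite sumr_ge0// => k _; rewrite exprn_ge0.
by rewrite sumr_ge0// => k _; rewrite sumr_ge0// => l _; rewrite exprn_ge0.
Qed.

Lemma mx_dnorm_le (A : M) : dnorm mx_dot A <= \sum_i \sum_j `|A i j|.
Proof.
have s0 : 0 <= \sum_i \sum_j `|A i j|.
  by rewrite sumr_ge0// => i _; rewrite sumr_ge0.
rewrite -(@ler_pXn2r _ 2)// ?nnegrE ?dnorm_nneg// sqr_dnorm.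
rewrite /mx_dot/= mx_dotE [leRHS]expr2 mulr_suml ler_sum// => i _.
rewrite mulr_suml ler_sum// => j _; rewrite expr2 ler_wpM2l//.
rewrite (bigD1 i)//= (bigD1 j)//= -addrA lerDl addr_ge0//.
  by rewrite sumr_ge0.
by rewrite sumr_ge0// => k _; rewrite sumr_ge0.
Qed.

Lemma mx_dot_complete : dot_complete mx_dot.
Proof.
move=> u uS.
have [l ul] : {l : M & forall i j n, `|u n i j - l i j| <= 4 * 2^-1 ^+ n}.
  have ex i j : exists l : C, forall n, `|u n i j - l| <= 4 * 2^-1 ^+ n.
    apply: cplx_geometric => n.
    apply: (@le_trans _ _ (2^-1 ^+ n)).
      by apply: le_trans (uS n); have := mx_entry_le (u n.+1 - u n) i j;
        rewrite !mxE.
    by rewrite ler_peMl ?exprn_ge0// ler1n.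
  exists (\matrix_(i, j) sval (cid (ex i j))) => i j n; rewrite mxE.
  exact: svalP (cid (ex i j)) n.
(* The p q entries are each within 4 / 2^n of their limits, and the norm is at most the sum of the
   moduli; the added 1 makes [c] positive and yields the clause [2^-1 ^+ n < e]. *)
exists l => e e0; pose c : C := p%:R * (q%:R * 4) + 1.
have c0 : 0 < c by rewrite ltr_wpDl// !mulr_ge0.
have [n hn] := geometric_lt (divr_gt0 e0 c0).
have {}hn : c * 2^-1 ^+ n < e by rewrite mulrC -ltr_pdivlMr.
have h0 : 0 < (2^-1 : C) ^+ n by rewrite exprn_gt0// invr_gt0.
exists n; split; apply: le_lt_trans hn; last first.
  by rewrite /c mulrDl mul1r lerDr !mulr_ge0// ltW.
apply: le_trans (mx_dnorm_le _) _.
apply: (@le_trans _ _ (\sum_(i < p) \sum_(j < q) 4 * 2^-1 ^+ n)).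
  by apply: ler_sum => i _; apply: ler_sum => j _; rewrite !mxE ul.
rewrite !sumr_const !card_ord -!mulrnA -[leLHS]mulr_natr /c [leRHS]mulrDl mul1r
  ler_wpDr ?(ltW h0)//.
by rewrite natrM le_eqVlt; apply/orP; left; apply/eqP; ring.
Qed.

Definition mx_hilbert : hilbert R := dot_hilbert mx_dot_complete.

Lemma mx_hilbert_finite : finite_dimensional mx_hilbert.
Proof.
exists (p * q)%N, (fun k => vec_mx (delta_mx 0 k) : M) => x.
exists (fun k => mxvec (x : M) 0 k).
rewrite -[LHS](mxvecK (x : M)) {1}[mxvec _]row_sum_delta linear_sum.
by apply: eq_bigr => k _; rewrite linearZ.
Qed.

End MatrixHilbert.

Section GramSchmidt.
Context (R : realType) (H : hilbert R).
Local Notation C := (cplx R).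
Local Notation dotH := (hdot H).

Definition orthonormal_fam m (e : 'I_m ->
  H) := forall a b, dotH (e a) (e b) = (a == b)%:R.

(** The residual of a new vector is normalized and adjoined only when nonzero, so linearly dependent
    lists are allowed. *)
Lemma gram_schmidt (s : seq H) : exists m (e : 'I_m -> H), orthonormal_fam e /\
  forall v, v \in s -> v = \sum_a dotH v (e a) *: e a.
Proof.
elim: s => [|v s [m [e [eo es]]]].
  by exists 0%N, (fun=> 0); split=> // -[].
pose r := v - \sum_a dotH v (e a) *: e a.
have vE : v = r + \sum_a dotH v (e a) *: e a by rewrite subrK.
have re b : dotH r (e b) = 0.
  rewrite dotBl dot_suml (bigD1 b)//= big1 ?addr0 => [|a ab].
    by rewrite dotZl eo eqxx mulr1 subrr.
  by rewrite dotZl eo (negPf ab) mulr0.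
have [r0|r0] := eqVneq r 0.
  exists m, e; split=> // w; rewrite inE => /predU1P[->|/es//].
  by apply/eqP; rewrite -subr_eq0 -/r r0.
have nr : `|r| != 0 by rewrite normr_eq0.
pose f a := if unlift ord0 a is Some b then e b else `|r|^-1 *: r.
have f0 : f ord0 = `|r|^-1 *: r by rewrite /f unlift_none.
have fS a : f (lift ord0 a) = e a by rewrite /f liftK.
have er b : dotH (e b) r = 0 by rewrite dotC re rmorph0.
exists m.+1, f; split=> [a b|w].
  have [a'|] := unliftP ord0 a => ->; have [b'|] := unliftP ord0 b => ->.
  - by rewrite !fS eo (inj_eq lift_inj).
  - by rewrite fS f0 dotZr er mulr0 eq_sym (negPf (neq_lift _ _)).
  - by rewrite fS f0 dotZl re mulr0 (negPf (neq_lift _ _)).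
  - rewrite f0 dotZl dotZr -hdotE eqxx geC0_conj ?invr_ge0//.
    by rewrite mulrA -expr2 exprVn mulVf// expf_neq0.
rewrite big_ord_recl f0; under eq_bigr do rewrite fS.
rewrite inE => /predU1P[->|ws].
  rewrite {1}vE; congr (_ + _).
  have -> : dotH v (`|r|^-1 *: r) = `|r|.
    rewrite dotZr {1}vE dotDl.
    rewrite dot_suml big1 ?addr0 => [|a _]; last by rewrite dotZl er mulr0.
    by rewrite -hdotE geC0_conj ?invr_ge0// expr2 mulKf.
  by rewrite scalerA mulfV// scale1r.
rewrite {1}(es _ ws) -[LHS]add0r; congr (_ + _).
rewrite {1}(es _ ws) dot_suml big1 ?scale0r// => a _.
by rewrite dotZl dotZr er !mulr0.
Qed.

Lemma parseval m (e : 'I_m -> H) (c : 'I_m -> C) : orthonormal_fam e ->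
  `|\sum_a c a *: e a| ^+ 2 = \sum_a `|c a| ^+ 2.
Proof.
move=> eo; rewrite hdotE dot_suml; apply: eq_bigr => a _.
rewrite dot_sumr (bigD1 a)//= big1 ?addr0 => [|b ba].
  by rewrite dotZl dotZr eo eqxx mulr1 normCK.
by rewrite dotZl dotZr eo eq_sym (negPf ba) !mulr0.
Qed.

(* Expand in an orthonormal basis of the span of the vectors. *)
Lemma tensor_contraction (T : finType) n (a : T -> 'I_n -> C) (M : C) :
  (forall c : 'I_n -> C, \sum_t `|\sum_k a t k * c k| ^+ 2 <=
    M * \sum_k `|c k| ^+ 2) ->
  forall v : 'I_n -> H,
    \sum_t `|\sum_k a t k *: v k| ^+ 2 <= M * \sum_k `|v k| ^+ 2.
Proof.
move=> aM v; have [m [e [eo ev]]] := gram_schmidt [seq v k | k <- enum 'I_n].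
pose c b k := dotH (v k) (e b).
have vE k : v k = \sum_b c b k *: e b by apply/ev/map_f; rewrite mem_enum.
have avE t : \sum_k a t k *: v k = \sum_b (\sum_k a t k * c b k) *: e b.
  under eq_bigr do rewrite vE scaler_sumr.
  rewrite exchange_big; apply: eq_bigr => b _; rewrite scaler_suml.
  by apply: eq_bigr => k _; rewrite scalerA.
under eq_bigr do rewrite avE parseval//.
under [in leRHS]eq_bigr do rewrite vE parseval//.
rewrite exchange_big [in leRHS]exchange_big mulr_sumr.
by apply: ler_sum => b _; exact: aM.
Qed.

End GramSchmidt.

(** * Operator norms and free polynomials *)

Section OperatorNorm.
Context (R : realType).
Local Notation C := (cplx R).
Local Notation "x %:C" := (real_complex _ x) : ring_scope.

Lemma normc_Re (z : C) : (complex.Re `|z|)%:C = `|z|.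
Proof. by rewrite RRe_real// normr_real. Qed.

Lemma l2norm_ge0 n (v : 'cV[C]_n) : 0 <= l2norm v.
Proof. exact: sqrtr_ge0. Qed.

Lemma sqr_l2norm n (v : 'cV[C]_n) : (l2norm v ^+ 2)%:C = \sum_i `|v i 0| ^+ 2.
Proof.
rewrite sqr_sqrtr; last by rewrite sumr_ge0// => i _; rewrite sqr_ge0.
by rewrite rmorph_sum; apply: eq_bigr => i _; rewrite rmorphXn/= normc_Re.
Qed.

Lemma l2normE n (v : 'cV[C]_n) : (l2norm v)%:C = dnorm (@mx_dot R n 1) v.
Proof.
apply/eqP; rewrite -(@eqrXn2 _ 2)// ?dnorm_nneg ?ler0c ?l2norm_ge0//.
rewrite sqr_dnorm -rmorphXn/= sqr_l2norm /mx_dot/= mx_dotE.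
by apply/eqP/eq_bigr => i _; rewrite big_ord1.
Qed.

Lemma l2norm_triangle n (v w : 'cV[C]_n) : l2norm (v + w) <=
  l2norm v + l2norm w.
Proof. by rewrite -lecR rmorphD/= !l2normE dnorm_triangle. Qed.

Lemma l2normZ n (a : R) (v : 'cV[C]_n) : 0 <= a ->
  l2norm (a%:C *: v) = a * l2norm v.
Proof.
move=> a0; apply: complexI; rewrite rmorphM/= !l2normE dnorm_scale.
by rewrite ger0_norm// ler0c.
Qed.

Lemma l2norm_eq0 n (v : 'cV[C]_n) : l2norm v = 0 -> v = 0.
Proof.
move=> v0; apply: (@dnorm_eq0P _ _ (@mx_dot R n 1)).
by rewrite -l2normE v0.
Qed.

Lemma l2norm0 n : l2norm (0 : 'cV[C]_n) = 0.
Proof. by rewrite -(scale0r 0) -[0]/(0%:C) l2normZ ?mul0r. Qed.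

Lemma l2norm_mul_le m n (A : 'M[C]_(m, n)) (v : 'cV[C]_n) :
  l2norm (A *m v) <= (\sum_i \sum_j complex.Re `|A i j|) * l2norm v.
Proof.
rewrite -lecR rmorphM/= !l2normE; apply: le_trans (mx_dnorm_le _) _.
rewrite rmorph_sum mulr_suml ler_sum// => i _ /=; rewrite big_ord1 mxE.
rewrite rmorph_sum mulr_suml; apply: le_trans (ler_norm_sum _ _ _) _.
by apply: ler_sum => j _; rewrite normrM /= normc_Re ler_wpM2l// mx_entry_le.
Qed.

Lemma opnorm_has_ubound m n (A : 'M[C]_(m, n)) :
  has_ubound [set l2norm (A *m v) | v in [set v | l2norm v <= 1]].
Proof.
exists (\sum_i \sum_j complex.Re `|A i j|) => _ [w /= w1 <-].
apply: le_trans (l2norm_mul_le _ _) _; rewrite ler_piMr// sumr_ge0// => i _.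
by rewrite sumr_ge0// => j _; rewrite -ler0c normc_Re.
Qed.

Lemma opnorm_mul m n (A : 'M[C]_(m, n)) (v : 'cV[C]_n) :
  l2norm (A *m v) <= opnorm A * l2norm v.
Proof.
have [v0|v0] := eqVneq (l2norm v) 0.
  by rewrite v0 mulr0 (l2norm_eq0 v0) mulmx0 l2norm0.
have vp : 0 < l2norm v by rewrite lt_def v0 l2norm_ge0.
rewrite -ler_pdivrMr// mulrC -l2normZ ?invr_ge0 ?l2norm_ge0//.
rewrite scalemxAr; apply: ub_le_sup; first exact: opnorm_has_ubound.
exists (((l2norm v)^-1)%:C *: v) => //=.
by rewrite l2normZ ?invr_ge0 ?l2norm_ge0// mulVf.
Qed.

Lemma opnorm_ge0 m n (A : 'M[C]_(m, n)) : 0 <= opnorm A.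
Proof.
apply: ub_le_sup; first exact: opnorm_has_ubound.
by exists 0; rewrite /= ?mulmx0 ?l2norm0.
Qed.

Lemma opnorm_le m n (A : 'M[C]_(m, n)) (r : R) : 0 <= r ->
  (forall v, l2norm (A *m v) <= r * l2norm v) -> opnorm A <= r.
Proof.
move=> r0 Ar; apply: ge_sup.
  by exists 0, 0; rewrite /= ?mulmx0 ?l2norm0.
move=> _ [w /= w1 <-]; apply: le_trans (Ar w) _.
by rewrite ler_piMr.
Qed.

End OperatorNorm.

Section BlockSums.
Context (V : nmodType) (p : nat) (p_ : 'I_p -> nat).

Lemma big_Rank (F : 'I_(\sum_i p_ i) -> V) :
  \sum_K F K = \sum_i \sum_k F (tagnat.Rank i k).
Proof.
rewrite sig_big_dep/= (reindex _ tagnat.sig_bij_on)/=.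
by apply: eq_bigr => K _; rewrite -[in LHS](tagnat.sig2K K).
Qed.
End BlockSums.

Section FreeEvaluation.
Context (R : realType) (d : nat).
Local Notation C := (cplx R).

Lemma differentiable_scale_fun (V W : normedModType C) (k : V ->
  C) (g : V -> W) x :
  differentiable k x -> differentiable g x ->
    differentiable (fun y => k y *: g y) x.
Proof.
move=> kd gd.
have lin : bilinear_for (GRing.Scale.Law.clone _ _ *:%R _)
    (GRing.Scale.Law.clone _ _ *:%R _) (fun (a : C) (w : W) => a *: w).
  split=> [w|a] b c e; first by rewrite scalerDl -[b *: c]/(b * c) -scalerA.
  by rewrite scalerDr scalerA mulrC -scalerA.
pose m := @bilinear_isBilinear.Build C C W W _ _ (fun (a : C) (w : W) => a *: w)
  lin.
pose B : {bilinear C -> W -> W} := HB.pack (fun (a : C) (w : W) => a *: w) m.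
apply: (@differentiable_comp _ _ _ _ (fun y => (k y,
  g y)) (fun p => B p.1 p.2)).
  exact: differentiable_pair.
by apply: differentiable_bilin => p; exact: scale_continuous.
Qed.

Lemma differentiable_sum_fun (V W : normedModType C) (I : Type) (s : seq I)
    (g : I -> V -> W) x : (forall i, differentiable (g i) x) ->
  differentiable (fun y => \sum_(i <- s) g i y) x.
Proof.
move=> gd; elim: s => [|i s IH].
  by under eq_fun do rewrite big_nil; exact: differentiable_cst.
by under eq_fun do rewrite big_cons; exact: differentiableD.
Qed.

Lemma freeval_differentiable n (p : freepoly R d) (x : mtuple R d n.+1) i j :
  differentiable (fun y : mtuple R d n.+1 => freeval y p i j) x.
Proof.
rewrite /freeval; under eq_fun do rewrite mmapE summxE.
apply: differentiable_sum_fun => w.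
have prodd (s : seq 'I_d) k : differentiable
    (fun y : mtuple R d n.+1 => (\prod_(r <- s) coord y r) k j) x.
  elim: s k => [|r s IH] k.
    by under eq_fun do rewrite big_nil; exact: differentiable_cst.
  under eq_fun do rewrite big_cons mxE.
  apply: differentiable_sum_fun => l; apply: differentiableM => //.
  by under eq_fun do rewrite coordE; exact: differentiable_coord.
under eq_fun do rewrite -mulmxE mul_scalar_mx mxE.
by apply: differentiableM => //; exact: differentiable_cst.
Qed.

Lemma freeval_dsum m n (x : mtuple R d m.+1) (y : mtuple R d n.+1) (p : freepoly
  R d) :
  freeval (tuple_dsum x y : mtuple R d (m + n.+1).+1) p =
  block_mx (freeval x p) 0 0 (freeval y p) :> 'M[C]_(m.+1 + n.+1).
Proof.
pose rel (A : 'M[C]_(m.+1 + n.+1)) (B : 'M[C]_m.+1) (D : 'M[C]_n.+1) :=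
  A = block_mx B 0 0 D.
have prodE (s : seq 'I_d) : rel (\prod_(r <- s) coord
      (tuple_dsum x y : mtuple R d (m + n.+1).+1) r)
    (\prod_(r <- s) coord x r) (\prod_(r <- s) coord y r).
  elim: s => [|r s IH]; first by rewrite !big_nil /rel -scalar_mx_block.
  rewrite !big_cons -!mulmxE IH coord_of_coord.
  by rewrite /rel (@mulmx_block _ m.+1 n.+1 m.+1 n.+1 m.+1 n.+1) !mulmx0 !mul0mx
    !addr0 add0r.
rewrite /freeval !mmapE; elim: (finmap.enum_fset _) => [|w s IH].
  by rewrite !big_nil block_mx0.
rewrite !big_cons {}IH -!mulmxE !mul_scalar_mx prodE.
by rewrite (@scale_block_mx _ m.+1 n.+1 m.+1 n.+1) !scaler0 (@add_block_mx _
  m.+1 n.+1 m.+1 n.+1) !addr0.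
Qed.

End FreeEvaluation.

Lemma subr_mxE (V : zmodType) m n (A B : 'M[V]_(m, n)) i j :
  (A - B) i j = A i j - B i j.
Proof. by rewrite !mxE. Qed.

Section BlockEntries.
Context (T : Type) (p q : nat) (p_ : 'I_p -> nat) (q_ : 'I_q -> nat).

Lemma mxblock_Rank (B : forall i j, 'M[T]_(p_ i,
  q_ j)) i j (k : 'I_(p_ i)) (l : 'I_(q_ j)) :
  (\mxblock_(i < p, j < q) B i j) (tagnat.Rank i k) (tagnat.Rank j l) =
    B i j k l.
Proof. by have /matrixP/(_ k l) := mxblockK B i j; rewrite mxE. Qed.

End BlockEntries.

Lemma mxdiag_Rank (V : nmodType) p n (X : 'M[V]_n) (i j : 'I_p) k l :
  (\mxdiag_(i < p) X) (tagnat.Rank i k) (tagnat.Rank j l) =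
    if i == j then X k l else 0.
Proof.
rewrite /mxdiag mxblock_Rank; case: eqP => _; last by rewrite mxE.
by rewrite conform_mx_id.
Qed.

(** * The ball of delta and the model formula *)

Section PolyBall.
Context (R : realType) (d J L : nat) (delta : 'M[freepoly R d]_(J, L)).
Local Notation C := (cplx R).
Local Notation "x %:C" := (real_complex _ x) : ring_scope.

Lemma mxfreeval_Rank n (x : mtuple R d n.+1) j i l k :
  mxfreeval delta x (tagnat.Rank j i) (tagnat.Rank l k) =
    freeval x (delta j l) i k.
Proof. exact: mxblock_Rank. Qed.

Lemma mxfreeval_mul n (x : mtuple R d n.+1) (v : 'cV[C]_(\sum_(l < L) n.+1)) j i
  :
  (mxfreeval delta x *m v) (tagnat.Rank j i) 0 =
  \sum_l \sum_k freeval x (delta j l) i k * v (tagnat.Rank l k) 0.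
Proof.
rewrite mxE big_Rank; apply: eq_bigr => l _; apply: eq_bigr => k _.
by rewrite mxfreeval_Rank.
Qed.

Lemma sqr_l2norm_Rank p n (v : 'cV[C]_(\sum_(l < p) n.+1)) :
  (l2norm v ^+ 2)%:C = \sum_l \sum_k `|v (tagnat.Rank l k) 0| ^+ 2.
Proof. by rewrite sqr_l2norm big_Rank. Qed.

Lemma sqr_l2norm_mxfreeval n (x : mtuple R d n.+1) (v : 'cV[C]_(\sum_(l < L)
  n.+1)) :
  (l2norm (mxfreeval delta x *m v) ^+ 2)%:C =
  \sum_j \sum_i `|\sum_l \sum_k freeval x (delta j l) i k * v (tagnat.Rank l k)
    0| ^+ 2.
Proof.
rewrite sqr_l2norm_Rank; apply: eq_bigr => j _; apply: eq_bigr => i _.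
by rewrite mxfreeval_mul.
Qed.

(** The operator bound in coordinates indexed by block and position, from which the hypothesis of
    [tensor_contraction] is read off. *)
Lemma mxfreeval_contraction n (x : mtuple R d n.+1) (r : R) :
  opnorm (mxfreeval delta x) <= r ->
  forall w : 'I_L -> 'I_n.+1 -> C,
    \sum_j \sum_i `|\sum_l \sum_k freeval x (delta j l) i k * w l k| ^+ 2
      <= (r ^+ 2)%:C * \sum_l \sum_k `|w l k| ^+ 2.
Proof.
move=> xr w.
pose v : 'cV[C]_(\sum_(l < L) n.+1) := \mxcol_(l < L) \col_(k < n.+1) w l k.
have vE l k : v (tagnat.Rank l k) 0 = w l k.
  have /matrixP/(_ k 0) := mxcolK (fun l => \col_(k < n.+1) w l k) l.
  by rewrite !mxE.
have r0 : 0 <= r by apply: le_trans xr; exact: opnorm_ge0.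
have : ((l2norm (mxfreeval delta x *m v)) ^+ 2)%:C <= ((r * l2norm v) ^+ 2)%:C.
  rewrite lecR ler_pXn2r// ?nnegrE ?mulr_ge0 ?l2norm_ge0//.
  by apply: le_trans (opnorm_mul _ _) _; rewrite ler_wpM2r ?l2norm_ge0.
rewrite exprMn [X in _ <= X]rmorphM/= sqr_l2norm_mxfreeval sqr_l2norm_Rank.
congr (_ <= _ * _).
  apply: eq_bigr => j _; apply: eq_bigr => i _; congr (`|_| ^+ 2).
  by apply: eq_bigr => l _; apply: eq_bigr => k _; rewrite vE.
by apply: eq_bigr => l _; apply: eq_bigr => k _; rewrite vE.
Qed.

(** Up to permutations of the bases, delta at a direct sum is the direct sum of its values, whose
    norm is the larger of the two norms. *)
Lemma poly_ball_dsum m n (x : mtuple R d m.+1) (y : mtuple R d n.+1) :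
  poly_ball delta m x -> poly_ball delta n y ->
  poly_ball delta (m + n.+1)%N (tuple_dsum x y : mtuple R d (m + n.+1).+1).
Proof.
rewrite /poly_ball/= => x1 y1; pose r :=
  Num.max (opnorm (mxfreeval delta x)) (opnorm (mxfreeval delta y)).
have r1 : r < 1 by rewrite gt_max x1.
apply: le_lt_trans r1; apply: opnorm_le; first by rewrite le_max opnorm_ge0.
have r0 : 0 <= r by rewrite le_max opnorm_ge0.
move=> v; rewrite -(@ler_pXn2r _ 2)// ?nnegrE ?mulr_ge0 ?l2norm_ge0//.
rewrite -lecR exprMn [X in _ <= X]rmorphM/= sqr_l2norm_mxfreeval
  sqr_l2norm_Rank.
pose w1 (l : 'I_L) (k : 'I_m.+1) :=
  v (@tagnat.Rank L (fun=> (m + n.+1).+1) l (lshift n.+1 k)) 0.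
pose w2 (l : 'I_L) (k : 'I_n.+1) :=
  v (@tagnat.Rank L (fun=> (m + n.+1).+1) l (rshift m.+1 k)) 0.
have -> : \sum_l \sum_k `|v (tagnat.Rank l k) 0| ^+ 2 =
    \sum_l \sum_k `|w1 l k| ^+ 2 + \sum_l \sum_k `|w2 l k| ^+ 2.
  by rewrite -big_split; apply: eq_bigr => l _;
    rewrite (@big_split_ord _ _ _ m.+1 n.+1).
rewrite mulrDr.
have h1 : opnorm (mxfreeval delta x) <= r by rewrite le_max lexx.
have h2 : opnorm (mxfreeval delta y) <= r by rewrite le_max lexx orbT.
apply: le_trans (lerD (mxfreeval_contraction h1 w1) (mxfreeval_contraction h2
  w2)).
rewrite -big_split le_eqVlt; apply/orP; left; apply/eqP;
  apply: eq_bigr => j _ /=.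
rewrite (@big_split_ord _ _ _ m.+1 n.+1)/=; congr (_ + _).
  apply: eq_bigr => i _; congr (`|_| ^+ 2); apply: eq_bigr => l _.
  rewrite freeval_dsum (@big_split_ord _ _ _ m.+1 n.+1)/= [X in _ + X]big1
    ?addr0.
    by apply: eq_bigr => k _; rewrite (@block_mxEul _ m.+1 n.+1 m.+1 n.+1).
  by move=> k _; rewrite (@block_mxEur _ m.+1 n.+1 m.+1 n.+1) mxE mul0r.
apply: eq_bigr => i _; congr (`|_| ^+ 2); apply: eq_bigr => l _.
rewrite freeval_dsum (@big_split_ord _ _ _ m.+1 n.+1)/= [X in X + _]big1 ?add0r.
  by apply: eq_bigr => k _; rewrite (@block_mxEdr _ m.+1 n.+1 m.+1 n.+1).
by move=> k _; rewrite (@block_mxEdl _ m.+1 n.+1 m.+1 n.+1) mxE mul0r.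
Qed.

(** A bound strictly below 1 on a whole neighbourhood, more than mere openness, later provides a
    factor 1 - r^2 that is uniform near [x]. *)
Lemma poly_ball_near n (x : mtuple R d n.+1) : poly_ball delta n x ->
  exists r : R, [/\ 0 <= r, r < 1 &
    \forall y \near x, opnorm (mxfreeval delta y) <= r].
Proof.
rewrite /poly_ball/=; set B := mxfreeval delta; set o := opnorm (B n x) => o1.
have o0 : 0 <= o by exact: opnorm_ge0.
(* The number of entries plus 1: entries moved by less than [e] change the norm by at most e N = (1
   - o) / 2, half the gap to 1. *)
pose N : R := \sum_(K < \sum_(j < J) n.+1) \sum_(K' < \sum_(l < L) n.+1) 1 + 1.
have N0 : 0 < N.
  by rewrite ltr_wpDl// sumr_ge0// => K _; rewrite sumr_ge0.
pose e := (1 - o) / 2 / N.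
have e0 : 0 < e by rewrite !divr_gt0// subr_gt0.
exists ((1 + o) / 2); split.
- by rewrite divr_ge0// addr_ge0.
- by rewrite ltr_pdivrMr// mul1r -[2]/(1 + 1) ltrD2l.
have Be : \forall y \near x, forall K K', `|B n y K K' - B n x K K'| < e%:C.
  apply: ((fun f => @filter_forall _ _ f _ (nbhs_filter x))
    (fun K => [set y | forall K', `|B n y K K' - B n x K K'| < e%:C])) => K.
  apply: ((fun f => @filter_forall _ _ f _ (nbhs_filter x))
    (fun K' => [set y | `|B n y K K' - B n x K K'| < e%:C])) => K'.
  have : {for x, continuous (fun y => B n y K K')}.
    apply: differentiable_continuous; rewrite /B /mxfreeval.
    by under eq_fun do rewrite mxE; exact: freeval_differentiable.
  move=> /cvgrPdist_lt/(_ e%:C); rewrite ltcR => /(_ e0).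
  by apply: filterS => y; rewrite distrC.
apply: filterS Be => y By; apply: opnorm_le;
  first by rewrite divr_ge0// addr_ge0.
move=> v; have -> : B n y = B n x + (B n y - B n x) by rewrite addrC subrK.
rewrite mulmxDl; apply: le_trans (l2norm_triangle _ _) _.
have -> : (1 + o) / 2 = o + (1 - o) / 2 by field.
rewrite mulrDl lerD ?opnorm_mul//; apply: le_trans (l2norm_mul_le _ _) _.
rewrite ler_wpM2r ?l2norm_ge0//.
have -> : (1 - o) / 2 = e * N by rewrite divfK// gt_eqF.
apply: (@le_trans _ _ (\sum_(K < \sum_(j < J) n.+1) \sum_(K' < \sum_(l < L)
  n.+1) e)).
  apply: ler_sum => K _; apply: ler_sum => K' _.
  by rewrite -lecR normc_Re subr_mxE ltW// By.
rewrite /N mulrDr mulr1 ler_wpDr ?(ltW e0)// mulr_sumr ler_sum// => K _.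
by rewrite mulr_sumr ler_sum// => K' _; rewrite mulr1.
Qed.

Lemma poly_ball_open n (x : mtuple R d n.+1) : poly_ball delta n x ->
  \forall y \near x, poly_ball delta n y.
Proof.
by move=> /poly_ball_near[r [_ r1]]; apply: filterS => y /le_lt_trans; exact.
Qed.

Section Model.
Context (H : hilbert R).

(** The formula of [model_cone], up to conversion, with the values of u replaced by free matrices
    [X] and [Y]; at a fixed pair of points it thus serves every Hilbert space of a family. *)
Definition model_value n (x y : mtuple R d n.+1) (X Y : 'M[H]_n.+1) :=
  let D := (mxfreeval delta y)^t* *m mxfreeval delta x in
  hadjmul (\mxdiag_(l < L) Y) (\mxdiag_(l < L) X - hmul D (\mxdiag_(l < L) X)).

(** Moving the adjoint of delta at [y] onto [Y] leaves a finite combination of inner products of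
    linear images of [X] and [Y]. Both the passage to ultralimits and the membership in [her] rest
    on this shape. *)
Lemma model_block n (x y : mtuple R d n.+1) (X Y : 'M[H]_n.+1) l l' :
  submxblock (model_value x y X Y) l l' =
  (if l == l' then hadjmul Y X else 0) -
  \sum_j hadjmul (hmul (freeval y (delta j l)) Y) (hmul (freeval x (delta j l'))
    X).
Proof.
apply/matrixP => a b; rewrite !mxE big_Rank (bigD1 l)//= [X in _ + X]big1
  ?addr0; last first.
  move=> k kl; rewrite big1// => c _; rewrite mxdiag_Rank (negPf kl) dot0r//.
rewrite summxE.
transitivity (\sum_c (hdot H (if l == l' then X c b else 0) (Y c a) -
   hdot H (\sum_e ((mxfreeval delta y)^t* *m mxfreeval delta x)
     (tagnat.Rank l c) (tagnat.Rank l' e) *: X e b) (Y c a))).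
  apply: eq_bigr => c _; rewrite mxdiag_Rank eqxx subr_mxE dotBl mxdiag_Rank;
    congr (_ - hdot H _ _).
  rewrite [LHS]mxE big_Rank (bigD1 l')//= [X in _ + X]big1 ?addr0.
    by apply: eq_bigr => e _; rewrite mxdiag_Rank eqxx.
  move=> k kl; rewrite big1// => e _; rewrite mxdiag_Rank (negPf kl) scaler0//.
rewrite sumrB; congr (_ - _).
  case: eqP => _; first by rewrite mxE.
  by rewrite mxE big1// => c _; rewrite dot0l.
have DE c e : ((mxfreeval delta y)^t* *m mxfreeval delta x) (tagnat.Rank l c)
  (tagnat.Rank l' e)
   = \sum_j \sum_i (freeval y (delta j l) i c)^* * freeval x (delta j l') i e.
  rewrite mxE big_Rank; apply: eq_bigr => j _; apply: eq_bigr => i _.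
  by rewrite -!mxfreeval_Rank; congr (_ * _); rewrite !mxE.
transitivity (\sum_c \sum_e \sum_j \sum_i
    (freeval y (delta j l) i c)^* * freeval x (delta j l') i e * hdot H (X e b)
      (Y c a)).
  apply: eq_bigr => c _; rewrite dot_suml; apply: eq_bigr => e _.
  rewrite dotZl DE mulr_suml; apply: eq_bigr => j _; rewrite mulr_suml.
  by apply: eq_bigr.
under eq_bigr do rewrite exchange_big.
rewrite exchange_big; apply: eq_bigr => j _.
rewrite mxE.
under eq_bigr do rewrite exchange_big.
rewrite exchange_big; apply: eq_bigr => i _.
rewrite !mxE dot_sumr; apply: eq_bigr => c _.
rewrite dot_suml; apply: eq_bigr => e _.
by rewrite dotZl dotZr mulrCA mulrA.
Qed.

(** For v the b-th column of [X], this diagonal entry is |v|^2 minus the squared norm of delta(x)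
    applied to e_l tensor v, and delta(x), amplified to [H], still has norm at most [r]. *)
Lemma model_value_bound n (x : mtuple R d n.+1) (X : 'M[H]_n.+1) (r : R) (l :
  'I_L) a b :
  r <= 1 -> opnorm (mxfreeval delta x) <= r ->
  (1 - r ^+ 2)%:C * `|X a b| ^+ 2 <=
    model_value x x X X (tagnat.Rank l b) (tagnat.Rank l b).
Proof.
move=> r1 xr; have r0 : 0 <= r by apply: le_trans xr; exact: opnorm_ge0.
have -> : model_value x x X X (tagnat.Rank l b) (tagnat.Rank l b)
    = submxblock (model_value x x X X) l l b b by rewrite [RHS]mxE.
rewrite model_block eqxx subr_mxE summxE.
pose S := \sum_c `|X c b| ^+ 2.
have -> : hadjmul X X b b = S by rewrite mxE; apply: eq_bigr => c _;
  rewrite hdotE.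
pose u (ji : 'I_J * 'I_n.+1) k := freeval x (delta ji.1 l) ji.2 k.
have uc (c : 'I_n.+1 -> C) : \sum_ji `|\sum_k u ji k * c k| ^+ 2
    <= (r ^+ 2)%:C * \sum_k `|c k| ^+ 2.
  (* Test vectors supported in block [l] restrict the bound to the l-th block column of delta(x). *)
  have := mxfreeval_contraction xr (fun l' k => if l' == l then c k else 0).
  rewrite [X in _ <= _ * X](bigD1 l)//= [X in _ <= _ * (_ + X)]big1; last first.
    by move=> l' /negPf l'l; rewrite big1// => k _; rewrite l'l normr0 expr0n.
  rewrite addr0 eqxx => h; apply: le_trans h.
  rewrite pair_bigA/= le_eqVlt; apply/orP; left; apply/eqP;
    apply: eq_bigr => -[j i] _ /=.
  congr (`|_| ^+ 2); rewrite (bigD1 l)//= [X in _ + X]big1 ?addr0 ?eqxx//.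
  by move=> l' /negPf l'l; rewrite big1// => k _; rewrite l'l mulr0.
have := tensor_contraction uc (fun k => X k b).
rewrite -/S => h.
have -> : \sum_j hadjmul (hmul (freeval x (delta j l)) X) (hmul (freeval x
  (delta j l)) X) b b
    = \sum_ji `|\sum_k u ji k *: X k b| ^+ 2.
  rewrite -(pair_bigA _ (fun j i => `|\sum_k u (j, i) k *: X k b| ^+ 2))/=.
  apply: eq_bigr => j _; rewrite mxE; apply: eq_bigr => i _.
  by rewrite -hdotE !mxE.
apply: (@le_trans _ _ ((1 - r ^+ 2)%:C * S)).
  rewrite ler_wpM2l ?ler0c ?subr_ge0 ?exprn_ile1//.
  by rewrite /S (bigD1 a)//= lerDl sumr_ge0// => k _; rewrite exprn_ge0.
by rewrite rmorphB rmorph1 mulrBl mul1r lerD2l lerN2.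
Qed.

End Model.
End PolyBall.

(** * Hereditary functions *)

Section HereditaryClosure.
Context (R : realType) (d : nat) (Omega : ncset R d).
Local Notation C := (cplx R).

Lemma hfun_nbhs p (A : hfun Omega p) (K : boxset Omega) (e : C) :
  finitely_compact K -> 0 < e ->
  nbhs A [set B | forall n x y, K n (x, y) -> `|A n x y - B n x y| < e].
Proof.
move=> Kc e0; have ent : entourage (@hfun_close R d Omega p K e).
  by exists K, e; split.
apply: filterS (nbhs_entourage A ent) => B /xsectionP; exact.
Qed.

Lemma hfun_nbhsP p (A : hfun Omega p) U : nbhs A U ->
  exists (K : boxset Omega) (e : C), [/\ finitely_compact K, 0 < e &
    forall B : hfun Omega p,
      (forall n x y, K n (x, y) -> `|A n x y - B n x y| < e) -> U B].
Proof.
rewrite -nbhs_entourageE => -[E [K [e [Kc e0 KE]]] EU].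
exists K, e; split=> // B AB; apply: EU; apply/xsectionP; exact: KE.
Qed.

Lemma hfun_closure p (S : set (hfun Omega p)) (A : hfun Omega p) :
  closure S A <-> forall (K : boxset Omega) (e : C), finitely_compact K ->
    0 < e ->
    exists2 B, S B & forall n x y, K n (x, y) -> `|A n x y - B n x y| < e.
Proof.
split=> [SA K e Kc e0|SA U /hfun_nbhsP[K [e [Kc e0 KU]]]].
  by have [B [SB AB]] := SA _ (hfun_nbhs A Kc e0); exists B.
by have [B SB AB] := SA K e Kc e0; exists B; split=> //; exact: KU.
Qed.

End HereditaryClosure.

(** * Finite rank approximation and the inclusion of the cone in the hereditary functions *)

Section FiniteNets.
Context (R : realType).
Local Notation C := (cplx R).

Lemma compact_net (T : topologicalType) (V : completeNormedModType C)
    (K : set T) (f : T -> V) (e : C) : compact K -> continuous f -> 0 < e ->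
  exists s : seq V, forall p, K p -> exists2 q, q \in s & `|f p - q| < e.
Proof.
move=> Kc fc e0.
have := continuous_compact (continuous_subspaceT fc) Kc.
rewrite compact_cover => /(_ V setT (fun v => (ball v e)^°)).
case=> [v _|_ [p Kp <-]|D _ Dcov]; first exact: open_interior.
  by exists (f p) => //; exact: nbhsx_ballx.
exists (finmap.enum_fset D) => p Kp.
have [q qD /interior_subset] := Dcov (f p) (ex_intro2 _ _ p Kp erefl).
by rewrite -ball_normE/= distrC => qp; exists q.
Qed.

End FiniteNets.

Lemma differentiable_scalar_comp (K : numFieldType) (V W : normedModType K)
    (l : W -> K) (g : V -> W) (c : K) (x : V) :
  (forall a u v, l (a *: u + v) = a * l u + l v) -> 0 <= c ->
  (forall w, `|l w| <= c * `|w|) ->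
  differentiable g x -> differentiable (fun y => l (g y)) x.
Proof.
move=> llin c0 lc gd.
pose Lm := GRing.isLinear.Build _ _ _ _ l llin.
pose L : {linear W -> K} := HB.pack l Lm.
have Lc : continuous L.
  apply/bounded_linear_continuous/linear_boundedP.
  exists c; split => [|M cM w]; first exact: ger0_real.
  by rewrite (le_trans (lc w))// ler_wpM2r// ltW.
have -> : (fun y => l (g y)) = L \o g by [].
apply: differentiable_comp => //; exact: linear_differentiable.
Qed.

Section FiniteRank.
Context (R : realType) (H : hilbert R) (m : nat) (e : 'I_m -> H).
Local Notation C := (cplx R).
Hypothesis eo : orthonormal_fam e.

Definition span_proj (v : H) := \sum_a hdot H v (e a) *: e a.

Lemma span_projB v w : span_proj (v - w) = span_proj v - span_proj w.
Proof.
by rewrite /span_proj -sumrB; apply: eq_bigr => a _; rewrite dotBl scalerBl.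
Qed.

Lemma span_proj_residual v : `|v - span_proj v| <= `|v|.
Proof.
rewrite -(@ler_pXn2r _ 2)// ?nnegrE// !hdotE dnormB.
have h : hdot H v (span_proj v) = `|span_proj v| ^+ 2.
  rewrite parseval// dot_sumr; apply: eq_bigr => a _.
  by rewrite dotZr mulrC normCK.
by rewrite h -!hdotE geC0_conj ?exprn_ge0// opprD addrA addrK gerBl exprn_ge0.
Qed.

(** The vectors [v] and [v - w] have the same residual, and a residual is no longer than its
    vector. *)
Lemma span_proj_dist v w : w = span_proj w -> `|v - span_proj v| <= `|v - w|.
Proof.
move=> we; apply: le_trans (span_proj_residual (v - w)).
by rewrite span_projB -we opprB addrA subrK.
Qed.

Lemma hdot_differentiable (V : normedModType C) (g : V -> H) (w : H) x :
  differentiable g x -> differentiable (fun y => hdot H (g y) w) x.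
Proof.
apply: (@differentiable_scalar_comp _ _ _ (fun v => hdot H v w) g `|w|).
- by move=> a u v; rewrite dotDl dotZl.
- by [].
- by move=> v; rewrite mulrC; exact: hdot_le.
Qed.
End FiniteRank.

Section Approximation.
Context (R : realType) (d : nat) (Omega : ncset R d) (H : hilbert R).
Arguments Omega : clear implicits.
Local Notation C := (cplx R).

Lemma hol_val_continuous (f : graded d H) n i j : hol Omega f ->
  continuous (fun xy : Omega n * Omega n => f n (val xy.1) i j) /\
  continuous (fun xy : Omega n * Omega n => f n (val xy.2) i j).
Proof.
move=> fh.
have fc : continuous (fun x : Omega n => f n (val x) i j).
  move=> x; apply: (@continuous_comp _ _ _ (val : Omega n ->
    _) (fun y => f n y i j)).
    exact: initial_continuous.
  by apply: differentiable_continuous; apply: fh; exact: set_valP.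
split=> x.
  apply: (@continuous_comp _ _ _ (fst : Omega n * Omega n -> Omega n)
    (fun x : Omega n => f n (val x) i j)); [exact: cvg_fst|exact: fc].
apply: (@continuous_comp _ _ _ (snd : Omega n * Omega n -> Omega n)
  (fun x : Omega n => f n (val x) i j)); [exact: cvg_snd|exact: fc].
Qed.

(** Only [w] has to be close to its projection P w: the inner product of P w with [v] is already an
    expression in the coordinates of both. The t-th row of a T x m matrix holds the coordinates of
    the t-th term, so the whole sum becomes one elementary function. *)
Lemma scalar_her_sum T (v w : 'I_T -> graded d H) (A : hfun Omega S) :
  (forall t, hol Omega (v t)) -> (forall t, hol Omega (w t)) ->
  (forall n x y, A n x y = \sum_t hadjmul (v t n (val y)) (w t n (val x))) ->
  scalar_her Omega A.
Proof.
move=> vh wh AE; apply/hfun_closure => K e Kc e0.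
have [Kcomp [N KN]] := Kc.
have nets (f : 'I_T -> graded d H) (side : forall n, Omega n * Omega n ->
  Omega n)
    (eps : C) : 0 < eps ->
    (forall t n i j, continuous (fun xy : Omega n * Omega n => f t n (val (side
      n xy)) i j)) ->
    exists s : seq H, forall n t i j xy, K n xy ->
      exists2 q, q \in s & `|f t n (val (side n xy)) i j - q| < eps.
  move=> eps0 fc.
  have /choice[s0 s0P] : forall n, exists s : seq H, forall t i j xy, K n xy ->
      exists2 q, q \in s & `|f t n (val (side n xy)) i j - q| < eps.
    move=> n.
    have /choice[s1 s1P] : forall tij : 'I_T * 'I_n.+1 * 'I_n.+1,
        exists s : seq H, forall xy, K n xy ->
        exists2 q, q \in s & `|f tij.1.1 n (val (side n xy)) tij.1.2 tij.2 - q|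
          < eps.
      move=> [[t i] j]; apply: (@compact_net _ _ _ (K n)
        (fun xy => f t n (val (side n xy)) i j)) => //; exact: fc.
    exists (flatten [seq s1 tij | tij <- enum {: 'I_T * 'I_n.+1 * 'I_n.+1}]).
    move=> t i j xy Kxy; have [q qs qe] := s1P (t, i, j) xy Kxy.
    exists q => //; apply/flattenP; exists (s1 (t, i, j)) => //.
    by apply: map_f; rewrite mem_enum.
  exists (flatten [seq s0 n | n <- iota 0 N]) => n t i j xy Kxy.
  have [q qs qe] := s0P n t i j xy Kxy.
  exists q => //; apply/flattenP; exists (s0 n) => //; apply: map_f.
  rewrite mem_iota add0n/= ltnNge; apply/negP => Nn.
  by move: Kxy; rewrite KN.
have [sv svP] := nets v (fun n xy => xy.2) 1 ltr01 (fun t n i j =>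
  (@hol_val_continuous (v t) n i j (vh t)).2).
(* The net of radius 1 for [v] serves to bound [v] on [K]. *)
pose M : C := \sum_(q <- sv) `|q| + 1.
have M0 : 0 < M by rewrite ltr_wpDl// sumr_ge0.
have vM n t i j xy : K n xy -> `|v t n (val xy.2) i j| <= M.
  move=> Kxy; have [q qs qe] := svP n t i j xy Kxy.
  rewrite -[v t n _ i j](subrK q) (le_trans (ler_normD _ _))// addrC /M lerD
    ?(ltW qe)//.
  by rewrite (big_rem _ qs)/= lerDl sumr_ge0.
(* An entry has at most T N terms, [K] being empty from level [N] on, and each errs by at most
   [eps * M]; the 1 keeps [c] positive. *)
pose c : C := T%:R * N%:R * M + 1.
have c0 : 0 < c by rewrite ltr_wpDl// !mulr_ge0// ltW.
pose eps := e / 2 / c.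
have eps0 : 0 < eps by rewrite !divr_gt0.
have [sw swP] := nets w (fun n xy => xy.1) eps eps0 (fun t n i j =>
  (@hol_val_continuous (w t) n i j (wh t)).1).
have [m [b [bo bs]]] := gram_schmidt sw.
pose approx (f : 'I_T -> graded d H) : graded d (mx_hilbert R T m) :=
  fun n x => \matrix_(i, j) (\matrix_(t, a) hdot H (f t n x i j) (b a)).
have approx_hol f : (forall t, hol Omega (f t)) -> hol Omega (approx f).
  move=> fh n x Ox i j.
  have -> : (fun y => approx f n y i j) = (fun y => \sum_t \sum_a
      hdot H (f t n y i j) (b a) *: (delta_mx t a : mx_hilbert R T m)).
    apply/funext => y; rewrite mxE [LHS]matrix_sum_delta.
    by apply: eq_bigr => t _; apply: eq_bigr => a _; rewrite mxE.
  apply: differentiable_sum_fun => t; apply: differentiable_sum_fun => a.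
  apply: differentiable_scale_fun; last exact: differentiable_cst.
  by apply: hdot_differentiable; exact: fh.
exists (fun n x y => hadjmul (approx v n (val y)) (approx w n (val x))).
  exists (mx_hilbert R T m); split; first exact: mx_hilbert_finite.
  by exists (approx w), (approx v); split=> //; exact: approx_hol.
move=> n x y Kxy; apply: (@le_lt_trans _ _ (e / 2)); last exact: half_lt.
apply/mx_norm_le; first by rewrite divr_ge0// ltW.
move=> i j; rewrite subr_mxE AE summxE.
have -> : hadjmul (approx v n (val y)) (approx w n (val x)) i j =
    \sum_t \sum_k hdot H (span_proj b (w t n (val x) k j)) (v t n (val y) k i).
  rewrite mxE exchange_big; apply: eq_bigr => t _; apply: eq_bigr => k _.
  rewrite dot_suml; apply: eq_bigr => a _.
  by rewrite /approx !mxE dotZl -dotC.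
rewrite -sumrB; apply: le_trans (ler_norm_sum _ _ _) _.
apply: (@le_trans _ _ (\sum_(t < T) \sum_(k < n.+1) eps * M)).
  apply: ler_sum => t _; rewrite mxE -sumrB;
    apply: le_trans (ler_norm_sum _ _ _) _.
  apply: ler_sum => k _; rewrite -dotBl; apply: le_trans (hdot_le _ _) _.
  have [q qs qe] := swP n t k j _ Kxy.
  apply: ler_pM => //; last exact: vM Kxy.
  by apply: le_trans (ltW qe); apply: span_proj_dist => //; exact: bs.
have nN : (n.+1 <= N)%N by rewrite ltnNge; apply/negP => Nn; move: Kxy;
  rewrite KN.
have -> : e / 2 = eps * c by rewrite /eps divfK// gt_eqF.
rewrite sumr_const card_ord sumr_const card_ord -mulrnA -[leLHS]mulr_natr.
rewrite -mulrA ler_pM2l// /c ler_wpDr// mulrC ler_wpM2r ?(ltW M0)//.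
by rewrite mulnC natrM ler_wpM2l// ler_nat.
Qed.

End Approximation.

Section ConeInHer.
Context (R : realType) (d J L : nat) (delta : 'M[freepoly R d]_(J, L)).

Lemma model_cone_her : model_cone delta `<=` her (poly_ball delta) L.
Proof.
move=> A [H [u [uh _ ->]]] l l'.
(* Index 0 carries the term of the identity, present when [l == l']; the other [J] indices carry
   those of delta, with the minus sign put into [tv]. *)
pose tv (t : 'I_J.+1) : graded d H := if unlift ord0 t is Some j
  then fun n x => - hmul (freeval x (delta j l)) (u n x) else u.
pose tw (t : 'I_J.+1) : graded d H := if unlift ord0 t is Some j
  then fun n x => hmul (freeval x (delta j l')) (u n x)
  else if l == l' then u else fun=> (fun=> 0).
have mul_hol j k : hol (poly_ball delta)
    (fun n x => hmul (freeval x (delta j k)) (u n x) : 'M[H]_n.+1).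
  move=> n x Ox a b; under eq_fun do rewrite mxE.
  apply: differentiable_sum_fun => c; apply: differentiable_scale_fun.
    exact: freeval_differentiable.
  exact: uh.
apply: (@scalar_her_sum _ _ _ H J.+1 tv tw).
- move=> t n x Ox a b; rewrite /tv; case: unliftP => [j _|_]; last exact: uh.
  under eq_fun do rewrite mxE.
  by apply: differentiableN; exact: mul_hol.
- move=> t n x Ox a b; rewrite /tw; case: unliftP => [j _|_];
  first exact: mul_hol.
  case: eqP => _; first exact: uh.
  by under eq_fun do rewrite mxE; exact: differentiable_cst.
move=> n x y; rewrite -[X in submxblock X]/(model_value delta (val x) (val y)
  (u n (val x)) (u n (val y))) model_block big_ord_recl; congr (_ + _).
  rewrite /tv /tw unlift_none; case: eqP => // _.
  by apply/matrixP => a b; rewrite !mxE big1// => c _; rewrite mxE dot0l.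
rewrite -sumrN; apply: eq_bigr => j _; rewrite /tv /tw liftK.
apply/matrixP => a b; rewrite [LHS]mxE [X in - X]mxE [RHS]mxE -sumrN.
by apply: eq_bigr => c _; rewrite [X in _ = hdot _ _ X]mxE dotNr.
Qed.
End ConeInHer.

(** If [z] is not a cluster point, the filter avoids a neighbourhood of [z], hence a tail of [Z],
    and lives on finitely many terms. *)
Lemma cvg_sequence_compact (T : topologicalType) (z : T) (Z : nat -> T) :
  Z @ \oo --> z -> compact (z |` range Z).
Proof.
move=> Zz F PF FK.
have [Fz|/existsNP[B /existsNP[U /not_implyP[FB /not_implyP[Uz BU]]]]] :=
    pselect (cluster F z).
  by exists z; split=> //; left.
have [N _ NU] := Zz U Uz.
have fin : finite_set [set Z k | k in `I_N] by exact: finite_image.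
have FN : F [set Z k | k in `I_N].
  apply: filterS (filterI FK FB) => y [[->|[k _ <-]] By].
    by exfalso; apply: BU; exists z; split=> //; exact: nbhs_singleton.
  exists k => //=; rewrite ltnNge; apply/negP => Nk; apply: BU.
  by exists (Z k); split=> //; exact: NU.
have [y [[k kN <-] cy]] := finite_compact fin PF FN.
by exists (Z k); split=> //; right; exists k.
Qed.

(** * Local boundedness of hereditary functions on the diagonal *)

Section BoxSequences.
Context (R : realType) (d : nat) (Omega : ncset R d).
Arguments Omega : clear implicits.
Local Notation C := (cplx R).

(* The level-n set {z} U {Z_k}, extended by the empty set at other levels. *)
Definition box_sequence n (z : Omega n * Omega n) (Z : nat ->
  Omega n * Omega n) :
    boxset Omega :=
  fun n' => [set xy | Tagged (fun n => (Omega n * Omega n)%type) xy =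
    Tagged _ z \/
    exists k, Tagged (fun n => (Omega n * Omega n)%type) xy = Tagged _ (Z k)].

Arguments box_sequence {n} z Z n' : rename.

Lemma box_sequence_compact n (z : Omega n * Omega n) Z :
  Z @ \oo --> z -> finitely_compact (box_sequence z Z).
Proof.
move=> Zz; split=> [n'|].
  have [E|ne] := eqVneq n' n; last first.
    rewrite (_ : box_sequence z Z n' = set0); first exact: compact0.
    rewrite -subset0 => xy [/(congr1 tag)/= nn|[k /(congr1 tag)/= nn]];
      by move: ne; rewrite nn eqxx.
  case: n / E z Z Zz => z Z Zz.
  rewrite (_ : box_sequence z Z n' = z |` range Z);
    first exact: cvg_sequence_compact.
  rewrite eqEsubset; split=> xy.
    move=> [h|[k h]]; first by left; exact: eq_from_Tagged h.
    by right; exists k => //; exact: esym (eq_from_Tagged h).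
  by move=> [->|[k _ <-]]; [left|right; exists k].
exists n.+1 => n' nn'; rewrite -subset0 => xy.
by move=> [/(congr1 tag)/= E|[k /(congr1 tag)/= E]]; move: nn'; rewrite E ltnn.
Qed.

(** The constant sequence shows that a single pair is finitely compact. *)
Lemma hfun_nbhs_point p (A : hfun Omega p) n (x y : Omega n) (e : C) : 0 < e ->
  nbhs A [set B | `|A n x y - B n x y| < e].
Proof.
move=> e0; have Kc : finitely_compact (box_sequence (x, y) (fun=> (x, y))).
  by apply: box_sequence_compact; exact: cvg_cst.
by apply: filterS (hfun_nbhs A Kc e0) => B; apply; left.
Qed.

Lemma mx_entry_norm m n (M : 'M[C]_(m, n)) i j : `|M i j| <= `|M|.
Proof. exact: (mx_norm_le M (normr_ge0 _)).1. Qed.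

Lemma expr_half_le (k l : nat) : (k <= l)%N -> (2^-1 : C) ^+ l <= 2^-1 ^+ k.
Proof.
by move=> kl; rewrite ler_wiXn2l// ?invr_ge0// invf_le1// ler1n.
Qed.

Lemma set_type_cvg n (z : Omega n) (Z : nat -> Omega n) :
  (forall k, `|val (Z k) - val z| < (2^-1 : C) ^+ k) -> Z @ \oo --> z.
Proof.
move=> Zz U; rewrite nbhsE => -[_ [[V Vo <-] Vz] VU].
have /nbhs_ballP[e /= e0 eV] : nbhs (val z) V by exact: open_nbhs_nbhs.
have [N hN] := geometric_lt e0.
exists N => // k /= Nk; apply: VU; apply: eV; rewrite -ball_normE/= distrC.
by apply: lt_trans (Zz k) _; apply: le_lt_trans hN; exact: expr_half_le.
Qed.

Lemma hol_bounded (H : hilbert R) (f : graded d H) n (x : Omega n) i j :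
  hol Omega f -> exists r : C, 0 < r /\
    forall y, `|y - val x| < r -> `|f n y i j| <= `|f n (val x) i j| + 1.
Proof.
move=> fh; have : {for val x, continuous (fun y => f n y i j)}.
  by apply: differentiable_continuous; apply: fh; exact: set_valP.
move=> /cvgrPdist_lt/(_ 1 ltr01) => h; have [r r0 rP] := nearby_ball h.
exists r; split=> // y /rP /= yx; rewrite -[f n y i j](subrK (f n (val x) i j)).
by rewrite (le_trans (ler_normD _ _))// addrC lerD2l distrC ltW.
Qed.

(* Along a sequence converging in Omega, a hereditary function is uniformly close
   to an elementary one. *)
Lemma her_diag_bounded L (A : hfun Omega (fun n => \sum_(l < L) n.+1)%N) n (x :
  Omega n)
    (l : 'I_L) b : her Omega L A ->
  exists r M : C, [/\ 0 < r, 0 <= M & forall z : Omega n,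
    `|val z - val x| < r ->
    `|A n z z (tagnat.Rank l b) (tagnat.Rank l b)| <= M].
Proof.
move=> Ah; pose a z := `|A n z z (tagnat.Rank l b) (tagnat.Rank l b)|.
apply: contrapT => nex.
have hp k : 0 < (2^-1 : C) ^+ k by rewrite exprn_gt0// invr_gt0.
(* If the bound fails, there are points [Z k] tending to [x] at which the entry is not at most 2^k,
   written [(2^-1 ^+ k)^-1]. *)
have /choice[Z ZP] : forall k, exists z : Omega n,
    `|val z - val x| < (2^-1 : C) ^+ k /\ ~ (a z <= (2^-1 ^+ k)^-1).
  move=> k; apply: contrapT => nz; apply: nex.
  exists (2^-1 ^+ k), ((2^-1 ^+ k)^-1); split;
    [exact: hp|by rewrite invr_ge0 ltW|].
  by move=> z zx; apply: contrapT => az; apply: nz; exists z.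
have Zx : Z @ \oo --> x by apply: set_type_cvg => k; have [] := ZP k.
have Kc : finitely_compact (box_sequence (x, x) (fun k => (Z k, Z k))).
  by apply: box_sequence_compact; apply: (cvg_pair Zx Zx).
have [B [K' [_ [u [v [uh vh BE]]]]] AB] :=
  (hfun_closure _ _).1 (Ah l l) _ 1 Kc ltr01.
have [r [r0 rP]] : exists r : C, 0 < r /\ forall c y, `|y - val x| < r ->
    `|u n y c b| <= `|u n (val x) c b| + 1 /\ `|v n y c b| <=
      `|v n (val x) c b| + 1.
  have near_bnd : \forall y \near val x, forall c,
    `|u n y c b| <= `|u n (val x) c b| + 1 /\ `|v n y c b| <=
      `|v n (val x) c b| + 1.
    apply: ((fun f => @filter_forall _ _ f _ (nbhs_filter (val x)))
      (fun c => [set y | `|u n y c b| <= `|u n (val x) c b| + 1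
        /\ `|v n y c b| <= `|v n (val x) c b| + 1])) => c.
    have [r1 [r10 r1P]] := hol_bounded x c b uh.
    have [r2 [r20 r2P]] := hol_bounded x c b vh.
    have [r [r0 rr1 rr2]] := gt0_lower_bound r10 r20.
    apply/nbhs_ballP; exists r => //= y; rewrite -ball_normE/= distrC => yx.
    by split; [apply: r1P|apply: r2P]; exact: lt_le_trans yx _.
  have [r r0 rP] := nearby_ball near_bnd.
  by exists r; split=> // c y yx; exact: rP.
pose M := \sum_c (`|u n (val x) c b| + 1) * (`|v n (val x) c b| + 1) + 1.
have M0 : 0 < M.
  by rewrite ltr_wpDl// sumr_ge0// => c _; rewrite mulr_ge0// addr_ge0.
have Minv : 0 < M^-1 by rewrite invr_gt0.
(* Once 2^-k < [c], the point [Z k] lies within [r] of [x] and 2^k exceeds [M], contrary to the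
   choice of [Z k]. *)
have [c [c0 cr cM]] := gt0_lower_bound r0 Minv.
have [k kc] := geometric_lt c0; have [Zk] := ZP k; apply.
apply: (@le_trans _ _ M); last first.
  by rewrite -[M]invrK lef_pV2 ?posrE// (le_trans (ltW kc)).
have ABk := AB n (Z k) (Z k) (or_intror (ex_intro _ k erefl)).
have Zkr : `|val (Z k) - val x| < r.
  by rewrite (lt_trans Zk)// (lt_le_trans kc).
have /le_lt_trans/(_ ABk) := mx_entry_norm
  (submxblock (A n (Z k) (Z k)) l l - B n (Z k) (Z k)) b b.
rewrite subr_mxE [submxblock _ _ _ b b]mxE BE => h.
rewrite /a -[A n _ _ _ _](subrK (hadjmul (v n (val (Z k))) (u n (val (Z k))) b
  b)).
rewrite (le_trans (ler_normD _ _))// addrC /M lerD ?(ltW h)//.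
rewrite mxE (le_trans (ler_norm_sum _ _ _))// ler_sum// => i _.
have [ui vi] := rP i _ Zkr.
by apply: le_trans (hdot_le _ _) _; apply: ler_pM.
Qed.

End BoxSequences.

Lemma cvg_sum_fun (K : numFieldType) (V : normedModType K) (I : Type)
    (F : set_system I) (FF : Filter F) (T : finType) (g : T -> I ->
      V) (l : T -> V) :
  (forall t, g t @ F --> l t) -> (fun i => \sum_t g t i) @ F --> \sum_t l t.
Proof.
move=> gl; elim: (index_enum T) => [|t s IH].
  by under eq_fun do rewrite big_nil; rewrite big_nil; exact: cvg_cst.
by under eq_fun do rewrite big_cons; rewrite big_cons; exact: cvgD.
Qed.

(** * Ultralimits of models and closedness of the cone *)

Section UltraLimit.
Context (R : realType) (d J L : nat) (delta : 'M[freepoly R d]_(J, L)).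
Context (I : Type) (F : set_system I) (FU : UltraFilter F) (E : I -> hilbert R).
Context (u : forall i, graded d (E i)).
Arguments u : clear implicits.
Local Notation C := (cplx R).
Local Notation Omega := (poly_ball delta).
Hypothesis u_nc : forall i, ncfun Omega (u i).
Hypothesis u_bounded : forall n (x : mtuple R d n.+1), Omega n x ->
  forall a b, ultra_bounded F (fun i => u i n x a b).

Definition ultra_graded : graded d (ultra_hilbert FU E) :=
  fun n x => \matrix_(a, b) ultra_vec FU (fun i => u i n x a b).

Lemma ultra_graded_hmul n m (x : mtuple R d n.+1) (A : 'M[C]_(m, n.+1)) a b :
  Omega n x ->
  ultra_bounded F (fun i => hmul A (u i n x) a b) /\
  ultra_vec FU (fun i => hmul A (u i n x) a b) = hmul A (ultra_graded x) a b.
Proof.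
move=> Ox.
have -> : (fun i => hmul A (u i n x) a b) =
  (fun i => \sum_k A a k *: u i n x k b).
  by apply: functional_extensionality_dep => i; rewrite mxE.
have [bnd ->] := ultra_vec_sum FU (A a) (fun k => u_bounded Ox k b).
by split=> //; rewrite mxE; apply: eq_bigr => k _; rewrite mxE.
Qed.

Lemma ultra_graded_nc : ncfun Omega ultra_graded.
Proof.
split=> [m n x y Ox Oy Oxy|n S x Su Ox Ox'].
  apply/matrixP => a b; rewrite mxE.
  have -> : (fun i => u i (m + n.+1)%N (tuple_dsum x y) a b) =
      (fun i => (block_mx (u i m x) 0 0 (u i n y) : 'M[E i]_(m.+1 + n.+1)) a b).
    by apply: functional_extensionality_dep => i; rewrite (u_nc i).1.
  have [{}a ->|{}a ->] := @split_ordP m.+1 n.+1 a;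
    have [{}b ->|{}b ->] := @split_ordP m.+1 n.+1 b.
  - rewrite (@block_mxEul _ m.+1 n.+1 m.+1 n.+1) mxE; congr (ultra_vec FU _).
    by apply: functional_extensionality_dep => i;
      rewrite (@block_mxEul _ m.+1 n.+1 m.+1 n.+1).
  - rewrite (@block_mxEur _ m.+1 n.+1 m.+1 n.+1) mxE -(ultra_vec0 FU);
    congr (ultra_vec FU _).
    by apply: functional_extensionality_dep => i;
      rewrite (@block_mxEur _ m.+1 n.+1 m.+1 n.+1) mxE.
  - rewrite (@block_mxEdl _ m.+1 n.+1 m.+1 n.+1) mxE -(ultra_vec0 FU);
    congr (ultra_vec FU _).
    by apply: functional_extensionality_dep => i;
      rewrite (@block_mxEdl _ m.+1 n.+1 m.+1 n.+1) mxE.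
  - rewrite (@block_mxEdr _ m.+1 n.+1 m.+1 n.+1) mxE; congr (ultra_vec FU _).
    by apply: functional_extensionality_dep => i;
      rewrite (@block_mxEdr _ m.+1 n.+1 m.+1 n.+1).
apply/matrixP => a b; rewrite !mxE.
have -> : (fun i => u i n (tuple_conj S x) a b) =
    (fun i => \sum_k invmx S k b *: hmul S (u i n x) a k).
  by apply: functional_extensionality_dep => i; rewrite (u_nc i).2// mxE.
have [_ ->] := ultra_vec_sum FU (fun k => invmx S k b)
  (fun k => (ultra_graded_hmul S a k Ox).1).
by apply: eq_bigr => k _; rewrite (ultra_graded_hmul S a k Ox).2.
Qed.

Lemma ultra_model_value n (x y : mtuple R d n.+1) K K' : Omega n x ->
  Omega n y ->
  (fun i => model_value delta x y (u i n x) (u i n y) K K') @ F -->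
    model_value delta x y (ultra_graded x) (ultra_graded y) K K'.
Proof.
move=> Ox Oy.
(* The coordinates of [K] and [K'] are chosen once for all Hilbert spaces, so that the same formula
   serves the family and its ultralimit. *)
have [l [l' [a [b mE]]]] : exists l l' a b,
  forall (H : hilbert R) (X Y : 'M[H]_n.+1),
    model_value delta x y X Y K K' = (if l == l' then hadjmul Y X else 0) a b -
    \sum_j hadjmul (hmul (freeval y (delta j l)) Y) (hmul (freeval x (delta j
      l')) X) a b.
  exists (tagnat.sig1 K), (tagnat.sig1 K'), (tagnat.sig2 K),
    (tagnat.sig2 K') => H X Y.
  by rewrite -summxE -subr_mxE -model_block [RHS]mxE !tagnat.sig2K.
rewrite mE (funext (fun i => mE (E i) (u i n x) (u i n y))); apply: cvgB.
  case: eqP => _; last first.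
    by under eq_fun do rewrite mxE; rewrite mxE; exact: cvg_cst.
  under eq_fun do rewrite mxE; rewrite mxE; apply: cvg_sum_fun => k.
  by rewrite !mxE; apply: ultra_vec_dot; exact: u_bounded.
apply: cvg_sum_fun => j; under eq_fun do rewrite mxE; rewrite mxE.
apply: cvg_sum_fun => k.
have [bx <-] := ultra_graded_hmul (freeval x (delta j l')) k b Ox.
have [by' <-] := ultra_graded_hmul (freeval y (delta j l)) k a Oy.
exact: ultra_vec_dot.
Qed.

End UltraLimit.

Section Closure.
Context (R : realType) (d J L : nat) (delta : 'M[freepoly R d]_(J, L)).
Local Notation C := (cplx R).
Local Notation Omega := (poly_ball delta).

(** The index [l] provides a diagonal block: its entry at [b] bounds the b-th column of [u] through
    [model_value_bound], with [r] and the bound on [A] uniform near each point. *)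
Lemma model_value_hol (H : hilbert R) (u : graded d H)
    (A : hfun Omega (fun n => \sum_(l < L) n.+1)%N) (l : 'I_L) :
  ncfun Omega u -> her Omega L A ->
  (forall n (x y : Omega n),
    A n x y = model_value delta (val x) (val y) (u n (val x)) (u n (val y))) ->
  hol Omega u.
Proof.
move=> unc Ah AE; apply: nc_holomorphic => //.
- by move=> n x Ox; exact: poly_ball_open.
- by move=> m n x y Ox Oy; exact: poly_ball_dsum.
move=> n x Ox; have [r [r0 r1 xr]] := poly_ball_near Ox.
have r2 : 0 < (1 - r ^+ 2 : R) by rewrite subr_gt0 exprn_ilt1.
pose q : C := real_complex R (1 - r ^+ 2).
have q0 : 0 < q by rewrite -(rmorph0 (real_complex R)) ltcR.
pose x' : Omega n := SigSub (mem_set Ox).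
have /choice[M MP] : forall b, exists M : C, 0 <= M /\ \forall y \near x,
    forall a, `|u n y a b| <= M.
  move=> b; have [s [M [s0 M0 sM]]] := @her_diag_bounded _ _ _ L A n x' l b Ah.
  (* The 1 avoids a square root: |u|^2 <= M / q implies |u| <= M / q + 1. *)
  exists (M / q + 1); split; first by rewrite addr_ge0// divr_ge0// ltW.
  have xs : \forall y \near x, `|y - x| < s.
    by apply/nbhs_ballP; exists s => // y; rewrite -ball_normE/= distrC.
  apply: filterS (filterI (filterI xr (poly_ball_open Ox)) xs) => y [[yr Oy] ys]
    a.
  pose y' : Omega n := SigSub (mem_set Oy).
  have := model_value_bound (u n y) l a b (ltW r1) yr.
  have := sM y' ys; rewrite AE /= => h1 h2.
  have h : `|u n y a b| ^+ 2 <= M / q.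
    have v0 := le_trans (mulr_ge0 (ltW q0) (exprn_ge0 2 (normr_ge0 _))) h2.
    rewrite ler_pdivlMr// mulrC (le_trans h2)//.
    by rewrite -(ger0_norm v0).
  have Mq : 0 <= M / q by rewrite divr_ge0// ltW.
  rewrite -(@ler_pXn2r _ 2)// ?nnegrE ?addr_ge0//; apply: le_trans h _.
  by rewrite sqrrD1 -addrA ler_wpDl ?exprn_ge0// mulr2n -addrA lerDl addr_ge0.
exists (\sum_b M b).
have near_all : \forall y \near x, forall b a, `|u n y a b| <= M b.
  apply: ((fun f => @filter_forall _ _ f _ (nbhs_filter x))
    (fun b => [set y | forall a, `|u n y a b| <= M b])) => b.
  by have [] := MP b.
apply: filterS near_all => y yM a b; apply: le_trans (yM b a) _.
by rewrite (bigD1 b)//= lerDl sumr_ge0// => k _; have [] := MP k.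
Qed.

Lemma model_cone_closure A : her Omega L A -> closure (model_cone delta) A ->
  model_cone delta A.
Proof.
move=> Ah Acl.
have [B [BC _]] := Acl setT filterT.
(* For [L] = 0 all matrices are empty, so [A] equals [B]; otherwise [l0] supplies the diagonal
   entries that bound u. *)
have [[l0]|L0] := pselect (exists l : 'I_L, True); last first.
  suff -> : A = B by [].
  apply: functional_extensionality_dep => n; apply/funext => x;
    apply/funext => y.
  by apply/matrixP => K; exfalso; apply: L0; exists (tagnat.sig1 K).
move=> _.
(* The index set of the ultraproduct is the function space itself, with an ultrafilter finer than
   the trace on the cone of the neighbourhoods of [A]. *)
pose F0 := within (model_cone delta) (nbhs A).
have F0P : ProperFilter F0 := within_nbhs_proper Acl.
have [F [FU F0F]] := ultraFilterLemma F0P.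
have Fcone : F (model_cone delta).
  by apply: F0F; rewrite /F0 /within/=; apply: filterE.
have Fnear D : nbhs A D -> F D.
  by move=> AD; apply: F0F; apply: filterS AD => B'.
have [H0 [u0 [_ u0nc _]]] := BC.
(* [ultra_graded_nc] asks for an nc-function at every index, also outside the cone, where the model
   of [B] serves as default. *)
pose P (B' : hfun Omega (fun n => \sum_(l < L) n.+1)%N) (Hu : {H : hilbert R &
  graded d H}) :=
  ncfun Omega (tagged Hu) /\ (model_cone delta B' -> forall n (x y : Omega n),
    B' n x y = model_value delta (val x) (val y) (tagged Hu n (val x)) (tagged
      Hu n (val y))).
have /choice[G GP] : forall B', exists Hu, P B' Hu.
  move=> B'; have [[H [u [_ unc B'E]]]|nB'] := pselect (model_cone delta B').
    by exists (existT _ H u); split=> // _ n x y; rewrite B'E.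
  by exists (existT _ H0 u0); split.
pose E B' : hilbert R := tag (G B').
pose u B' : graded d (E B') := tagged (G B').
have unc B' : ncfun Omega (u B') by have [] := GP B'.
have uE : \forall B' \near F, forall n (x y : Omega n), B' n x y =
    model_value delta (val x) (val y) (u B' n (val x)) (u B' n (val y)).
  by apply: filterS Fcone => B' B'C; have [_ /(_ B'C)] := GP B'.
have Fcvg n (x y : Omega n) K K' : (fun B' : hfun Omega _ => B' n x y K K') @ F
  --> A n x y K K'.
  apply/cvgrPdist_lt => e e0; apply: filterS (Fnear _ (hfun_nbhs_point A x y
    e0)) => B' h.
  by apply: le_lt_trans h; rewrite -subr_mxE; exact: mx_entry_norm.
have ub n (x : mtuple R d n.+1) : Omega n x ->
    forall a b, ultra_bounded F (fun B' => u B' n x a b).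
  move=> Ox a b; pose x' : Omega n := SigSub (mem_set Ox).
  pose r := opnorm (mxfreeval delta x).
  have r1 : r < 1 by exact: Ox.
  have r2 : 0 < (1 - r ^+ 2 : R) by rewrite subr_gt0 exprn_ilt1// opnorm_ge0.
  pose q : C := real_complex R (1 - r ^+ 2).
  have q0 : 0 < q by rewrite -(rmorph0 (real_complex R)) ltcR.
  pose K : 'I_(\sum_(l < L) n.+1) := tagnat.Rank l0 b.
  (* [F]-many functions are within 1 of [A] at this entry, whence the numerator. *)
  pose M : C := (`|A n x' x' K K| + 1) / q.
  have M0 : 0 <= M by rewrite divr_ge0 ?addr_ge0// ltW.
  exists (M + 1).
  have /cvgrPdist_lt/(_ 1 ltr01) hc := Fcvg n x' x' K K.
  apply: filterS (filterI uE hc) => B' [B'E h].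
  have := model_value_bound (u B' n x) l0 a b (ltW r1) (lexx _).
  have := B'E n x' x'; rewrite /= => <- h2.
  have {}h2 : `|u B' n x a b| ^+ 2 <= M.
    have B0 := le_trans (mulr_ge0 (ltW q0) (exprn_ge0 2 (normr_ge0 _))) h2.
    rewrite ler_pdivlMr// mulrC (le_trans h2)//.
    rewrite -(ger0_norm B0) -[B' n x' x' K K](subKr (A n x' x' K K)).
    by rewrite (le_trans (ler_normB _ _))// lerD2l ltW.
  rewrite -(@ler_pXn2r _ 2)// ?nnegrE ?addr_ge0//; apply: le_trans h2 _.
  by rewrite sqrrD1 -addrA ler_wpDl ?exprn_ge0// mulr2n -addrA lerDl addr_ge0.
pose v := ultra_graded FU u.
have vnc : ncfun Omega v by exact: ultra_graded_nc.
have AE n (x y : Omega n) :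
    A n x y = model_value delta (val x) (val y) (v n (val x)) (v n (val y)).
  apply/matrixP => K K'.
  have h := @ultra_model_value _ _ _ _ delta _ F FU E u ub n (val x) (val y) K
    K'
    (set_valP x) (set_valP y).
  apply: (cvg_unique (@norm_hausdorff _ _) (Fcvg n x y K K')).
  apply: cvg_trans h; apply: near_eq_cvg.
  by apply: filterS uE => B' ->.
exists (ultra_hilbert FU E), v; split=> //.
  exact: (model_value_hol l0 vnc Ah AE).
apply: functional_extensionality_dep => n; apply/funext => x; apply/funext => y.
exact: AE.
Qed.

End Closure.

Theorem theorem5p4 (R : realType) (d J L : nat)
    (delta : 'M[freepoly R d]_(J, L)) :
  model_cone delta `<=` her (poly_ball delta) L /\
  closed [set A : her (poly_ball delta) L | model_cone delta (set_val A)].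
Proof.
split; first exact: model_cone_her.
move=> A Acl; apply: model_cone_closure; first exact: set_valP.
(* [her] carries the initial topology, so a neighbourhood of [A] among all functions pulls back
   along [set_val] and meets the cone there. *)
move=> U /initial_continuous AU; have [B [BC BU]] := Acl _ AU.
by exists (set_val B).
Qed.
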